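(* The matrix $$\mathcal U=\begin{pmatrix} E'-\frac{M}{R^2}\mathcal F & 0 & \frac1R-\frac{M\mathcal G}{R^2}\\ \delta B\mathcal F & A & \delta \mathcal G B\\ \mathcal F & \sigma\sqrt{2E+2M/R} & \mathcal G\end{pmatrix}$$ is non-singular for $R\ne 2M$ provided $(R,R_0,E,M,t)\in\mathcal T$. Moreover, if for some $z_0>0$ these conditions ($R\neq 2M$ and membership in $\mathcal T$) hold for $(R,R_0,E,M,t)[z]$ at $z=z_0$, then the system $$\frac{dr}{dz}=\frac{\mathcal G A R}{\mathcal G E'R-\mathcal F}-\frac{R_z\,(M\mathcal G-R)\sqrt{1+2E}}{R\,(\delta\sigma\sqrt{2E+2M/R}-\sqrt{1+2E})(\mathcal G E'R-\mathcal F)},$$ $$\frac{dt}{dz}=\frac{\delta R_z}{\delta\sigma\sqrt{2E+2M/R}-\sqrt{1+2E}},$$ $$\frac{dM}{dz}=\frac{-\mathcal F R A}{\mathcal G E'R-\mathcal F}-\frac{R_z\,(R^2E'-\mathcal F M)\sqrt{1+2E}}{R\,(\delta\sigma\sqrt{2E+2M/R}-\sqrt{1+2E})(\mathcal G E'R-\mathcal F)}$$ for the unknown $\vec X=(r,t,M)^T$ (with the given values at $z_0$) has a unique $C^\infty$ solution $\vec X[z]$ in some open interval containing $z_0$.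
   Context: A prime denotes $d/dr$. The data are smooth functions $E(r)$, $R_0(r)$ and a smooth positive function $R=R[z]$, with $R_z=dR[z]/dz$; $\sigma,\delta\in\{\pm1\}$ are constants (in the underlying Lemaître–Tolman–Bondi model, $\sigma=\operatorname{sgn}\partial_tR$, $\delta=\operatorname{sgn}\partial_rR$, where $R(t,r)$ solves $\partial_tR=\sigma\sqrt{2E+2M/R}$, $R(t_0,r)=R_0(r)$ with $t_0>0$ fixed). For quantities depending on $(t,r)$, $f[z]=f(t(z),r(z))$. In the system, $R=R[z]$, $E=E(r(z))$, $E'=E'(r(z))$, $R_0=R_0(r(z))$, $R_0'=R_0'(r(z))$. One restricts to $R,R_0,t>0$, $M\ge -ER$, $E>0$, and it is a standing assumption that $\partial_tR,\partial_rR,\partial^2_{t,r}R\neq0$ (in particular $E+M/R>0$). Set $$B=\frac{\sigma\sqrt{2E+2M/R}}{1+z},\qquad A=B\sqrt{1+2E},$$ $$J(R,R_0,M,E,t)=\sqrt2(t-t_0)-\sigma\int_{R_0}^R\sqrt{\frac{\tau}{\tau E+M}}\,d\tau ,$$ and define $\mathcal F,\mathcal G$ by $-(\partial_RJ)\mathcal F=E'\partial_EJ+R_0'\partial_{R_0}J$ and $-(\partial_RJ)\mathcal G=\partial_MJ$. The set $\mathcal T$: let $\mathfrak O^{\pm}$ be the smooth manifold of points $(R,R_0,E,M,t)$ (in the region above) with $J=0$, for $\sigma=\pm1$ respectively. Consider the maps $\phi^\pm(t,r)=(R(t,r),R_0(r),E(r),M(r),t)\in\mathfrak O^\pm$. Let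 $\pi\mathcal M^\pm\subset\mathfrak O^\pm$ be the set of points at which, with the values $E',R_0'$ given by the push-forward $d\phi^\pm$, the equation $E'R\,\partial_MJ=E'\,\partial_EJ+R_0'\,\partial_{R_0}J$ holds. Then $\mathcal T=(\mathfrak O^+\setminus\pi\mathcal M^+)\cup(\mathfrak O^-\setminus\pi\mathcal M^-)$; thus membership in $\mathcal T$ means $J=0$ and $E'R\,\partial_MJ\ne E'\partial_EJ+R_0'\partial_{R_0}J$ at the point. *)

(* Defs.v *)
(* Concrete reals of Stdlib with Coquelicot for the calculus; MathComp is used
   only for 3 x 3 matrices over R (field structure on R from Rstruct).

   [Ra], [Ra0] are the numbers usually written R (areal radius) and R_0; [dE],
   [dRa0], [dRa] are the values of E'(r), R_0'(r), dR[z]/dz. *)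
From mathcomp Require Import all_boot ssralg matrix.
From mathcomp Require Import Rstruct.
From Stdlib Require Import Reals.
From Coquelicot Require Import Coquelicot.

Open Scope ring_scope.

Definition mx3 (T : Type) (a11 a12 a13 a21 a22 a23 a31 a32 a33 : T) : 'M[T]_3 :=
  \matrix_(i < 3, j < 3)
    nth a11 (nth [::] [:: [:: a11; a12; a13];
                          [:: a21; a22; a23];
                          [:: a31; a32; a33]] i) j.
Arguments mx3 {T}.

Close Scope ring_scope.
Open Scope R_scope.

Definition smooth_on (U : R -> Prop) (f : R -> R) : Prop :=
  forall (n : nat) (x : R), U x -> ex_derive_n f n x.

(* sigma * sqrt (2E + 2M/R) *)
Definition W (sigma Ra M E : R) : R := sigma * sqrt (2 * E + 2 * M / Ra).

Definition B (sigma z Ra M E : R) : R := W sigma Ra M E / (1 + z).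

Definition A (sigma z Ra M E : R) : R := B sigma z Ra M E * sqrt (1 + 2 * E).

Definition J (sigma t0 Ra Ra0 M E t : R) : R :=
  sqrt 2 * (t - t0)
  - sigma * RInt (fun tau => sqrt (tau / (tau * E + M))) Ra0 Ra.

Definition J_Ra (sigma t0 Ra Ra0 M E t : R) : R :=
  Derive (fun x => J sigma t0 x Ra0 M E t) Ra.
Definition J_Ra0 (sigma t0 Ra Ra0 M E t : R) : R :=
  Derive (fun x => J sigma t0 Ra x M E t) Ra0.
Definition J_M (sigma t0 Ra Ra0 M E t : R) : R :=
  Derive (fun x => J sigma t0 Ra Ra0 x E t) M.
Definition J_E (sigma t0 Ra Ra0 M E t : R) : R :=
  Derive (fun x => J sigma t0 Ra Ra0 M x t) E.

(* F and G are the solutions of  - J_R F = E' J_E + R_0' J_{R_0}  and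
   - J_R G = J_M; on [region] below, J_R = - sigma sqrt (R / (R E + M)) <> 0. *)
Definition F (sigma t0 dE dRa0 Ra Ra0 M E t : R) : R :=
  (dE * J_E sigma t0 Ra Ra0 M E t + dRa0 * J_Ra0 sigma t0 Ra Ra0 M E t)
  / (- J_Ra sigma t0 Ra Ra0 M E t).
Definition G (sigma t0 Ra Ra0 M E t : R) : R :=
  J_M sigma t0 Ra Ra0 M E t / (- J_Ra sigma t0 Ra Ra0 M E t).

(* E + M/R > 0 is the condition d_t R <> 0; the condition E + M/R_0 > 0 is the
   same one at t = t_0.  Together they say tau * E + M > 0 for all tau between
   R_0 and R, so that the integrand of J is real and J is smooth. *)
Definition region (Ra Ra0 M E t : R) : Prop :=
  0 < Ra /\ 0 < Ra0 /\ 0 < t /\ 0 < E /\ 0 < E + M / Ra /\ 0 < E + M / Ra0.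

(* The manifold O^+ or O^-, for sigma = 1 or -1. *)
Definition in_O (sigma t0 Ra Ra0 M E t : R) : Prop :=
  region Ra Ra0 M E t /\ J sigma t0 Ra Ra0 M E t = 0.

Definition in_piM (sigma t0 dE dRa0 Ra Ra0 M E t : R) : Prop :=
  in_O sigma t0 Ra Ra0 M E t /\
  dE * Ra * J_M sigma t0 Ra Ra0 M E t
  = dE * J_E sigma t0 Ra Ra0 M E t + dRa0 * J_Ra0 sigma t0 Ra Ra0 M E t.

Definition in_T (t0 dE dRa0 Ra Ra0 M E t : R) : Prop :=
  (in_O 1 t0 Ra Ra0 M E t /\ ~ in_piM 1 t0 dE dRa0 Ra Ra0 M E t) \/
  (in_O (-1) t0 Ra Ra0 M E t /\ ~ in_piM (-1) t0 dE dRa0 Ra Ra0 M E t).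

Definition U (sigma delta t0 z dE dRa0 Ra Ra0 M E t : R) : 'M[R]_3 :=
  let f := F sigma t0 dE dRa0 Ra Ra0 M E t in
  let g := G sigma t0 Ra Ra0 M E t in
  let b := B sigma z Ra M E in
  mx3 (dE - M / Ra ^ 2 * f)  0                      (1 / Ra - M * g / Ra ^ 2)
      (delta * b * f)        (A sigma z Ra M E)     (delta * g * b)
      f                      (W sigma Ra M E)       g.

Definition den1 (sigma delta Ra M E : R) : R :=
  delta * W sigma Ra M E - sqrt (1 + 2 * E).
Definition den2 (sigma t0 dE dRa0 Ra Ra0 M E t : R) : R :=
  G sigma t0 Ra Ra0 M E t * dE * Ra - F sigma t0 dE dRa0 Ra Ra0 M E t.

Definition rhs_r (sigma delta t0 z dRa dE dRa0 Ra Ra0 M E t : R) : R :=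
  let g := G sigma t0 Ra Ra0 M E t in
  let D1 := den1 sigma delta Ra M E in
  let D2 := den2 sigma t0 dE dRa0 Ra Ra0 M E t in
  g * A sigma z Ra M E * Ra / D2
  - dRa * (M * g - Ra) * sqrt (1 + 2 * E) / (Ra * D1 * D2).

Definition rhs_t (sigma delta dRa Ra M E : R) : R := delta * dRa / den1 sigma delta Ra M E.

Definition rhs_M (sigma delta t0 z dRa dE dRa0 Ra Ra0 M E t : R) : R :=
  let f := F sigma t0 dE dRa0 Ra Ra0 M E t in
  let D1 := den1 sigma delta Ra M E in
  let D2 := den2 sigma t0 dE dRa0 Ra Ra0 M E t in
  - f * Ra * A sigma z Ra M E / D2
  - dRa * (Ra ^ 2 * dE - f * M) * sqrt (1 + 2 * E) / (Ra * D1 * D2).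

(* Where the right-hand sides are meaningful.  [Dr] is the domain of the data
   E(r), R_0(r) and [Dz] that of R[z] ([Rafun]).  A solution is required to stay there,
   since division and sqrt are total on R. *)
Definition ode_domain (sigma delta t0 : R) (Dr Dz : R -> Prop) (Efun Ra0fun Rafun : R -> R)
    (z r t M : R) : Prop :=
  Dz z /\ Dr r /\ 1 + z <> 0 /\
  region (Rafun z) (Ra0fun r) M (Efun r) t /\
  den1 sigma delta (Rafun z) M (Efun r) <> 0 /\
  den2 sigma t0 (Derive Efun r) (Derive Ra0fun r)
       (Rafun z) (Ra0fun r) M (Efun r) t <> 0.

Definition is_solution (sigma delta t0 : R) (Dr Dz : R -> Prop)
    (Efun Ra0fun Rafun : R -> R) (a b : R) (r t M : R -> R) : Prop :=
  forall z : R, a < z < b ->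
    ode_domain sigma delta t0 Dr Dz Efun Ra0fun Rafun z (r z) (t z) (M z) /\
    is_derive r z
      (rhs_r sigma delta t0 z (Derive Rafun z) (Derive Efun (r z)) (Derive Ra0fun (r z))
             (Rafun z) (Ra0fun (r z)) (M z) (Efun (r z)) (t z)) /\
    is_derive t z
      (rhs_t sigma delta (Derive Rafun z) (Rafun z) (M z) (Efun (r z))) /\
    is_derive M z
      (rhs_M sigma delta t0 z (Derive Rafun z) (Derive Efun (r z)) (Derive Ra0fun (r z))
             (Rafun z) (Ra0fun (r z)) (M z) (Efun (r z)) (t z)).

(* A C^oo solution on ]a, b[ with X[z0] = (r0, t1, M0). *)
Definition smooth_solution_through (sigma delta t0 : R) (Dr Dz : R -> Prop)
    (Efun Ra0fun Rafun : R -> R) (a b z0 r0 t1 M0 : R) (r t M : R -> R) : Prop :=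
  smooth_on (fun z => a < z < b) r /\
  smooth_on (fun z => a < z < b) t /\
  smooth_on (fun z => a < z < b) M /\
  is_solution sigma delta t0 Dr Dz Efun Ra0fun Rafun a b r t M /\
  r z0 = r0 /\ t z0 = t1 /\ M z0 = M0.

(* Main.v *)
Require Import Defs.
From mathcomp Require Import all_boot ssralg matrix.
From mathcomp Require Import Rstruct.
From Stdlib Require Import Reals.
From Coquelicot Require Import Coquelicot.
From Stdlib Require Import Lra Classical ClassicalEpsilon FunctionalExtensionality.

(** Expanding the determinant of the matrix gives
    [- B D1 D2 / R], where [D1 = den1] and [D2 = den2] are the two denominators
    of the system and [B] is proportional to [W = sigma sqrt (2E + 2M/R)], which
    is nonzero because [E + M/R > 0].  If [D1 = 0] then, squaring,
    [2E + 2M/R = 1 + 2E], that is [R = 2M].  The derivatives of [J] in [R], [R_0],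
    [M], [E] all carry the factor [sigma], so the condition defining the set T
    does not see the sign, and it says exactly that [D2 <> 0].  So the first
    half holds, and at [z_0] the system is regular.

    For the second half the analysis of [J] is reduced to elementary functions:
    on the region considered the integrand has the primitive
    [sqrt (tau (tau E + M)) / E - M E^(-3/2) ln (sqrt (tau E) + sqrt (tau E + M))],
    for either sign of [M], so no parametric integral remains
    ([J_closed_form], [J_RaE], [J_Ra0E], [J_ME], [J_EE]).  The right-hand sides are
    then obtained from constants and coordinates by sums, products and
    composition with smooth functions of one variable: the data, their
    derivatives, inverse, square root and logarithm.

    This is recorded by the inductive predicate [smooth_term], and two inductions
    on it supply all the regularity needed.  A smooth term is Lipschitz near the
    base point ([smooth_term_lipschitz]), which feeds the Picard-Lindelof
    theorem ([picard_lindelof]) and local uniqueness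
    ([integral_curve_unique_near]), the latter propagated to the whole interval by
    connectedness.  And a smooth term composed with an [n] times differentiable
    curve is [n] times differentiable ([smooth_term_ndiff]); applied to the
    right-hand side along a solution this gains one derivative at a time and shows
    that the solution is smooth.  [local_flow] collects this for an autonomous
    field; the variable [z] is made a fourth coordinate with derivative 1. *)

Open Scope R_scope.

(** * Repeated differentiability at a point *)

(** Each derivative is required to exist on some neighbourhood only, which may
    shrink with the order: this germ-like form makes sums, products and
    compositions a plain induction on the order, and lets a differential equation
    be used as the induction step. *)
Fixpoint ndiff (n : nat) (f : R -> R) (x : R) : Prop :=
  match n with
  | O => True
  | S m => exists g : R -> R,
      locally x (fun y => is_derive f y (g y)) /\ ndiff m g x
  end.

Definition smooth_at (f : R -> R) (x : R) : Prop := forall n, ndiff n f x.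

(** The product and chain rules need [f] itself at order [n], besides its
    derivative. *)
Lemma ndiff_pred n f x : ndiff (S n) f x -> ndiff n f x.
Proof.
elim: n f => [//|n IH] f [g [fg gn]].
by exists g; split=> //; apply: IH.
Qed.

Lemma ndiff_continuous n f x : ndiff (S n) f x -> continuous f x.
Proof.
move=> [g [fg _]]; apply: ex_derive_continuous.
by exists (g x); apply: (locally_singleton _ _ fg).
Qed.

Lemma ndiff_ext n f g x :
  locally x (fun y => f y = g y) -> ndiff n f x -> ndiff n g x.
Proof.
case: n => [//|n] fg [h [fh hn]]; exists h; split=> //.
apply: filter_imp (filter_and _ _ (locally_locally _ _ fg) fh) => y [fgy fhy].
exact: is_derive_ext_loc fgy fhy.
Qed.

Lemma ndiff_const n c x : ndiff n (fun _ => c) x.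
Proof.
elim: n c => [//|n IH] c; exists (fun _ => 0); split=> //.
by apply: filter_forall => y; apply: is_derive_const.
Qed.

Lemma ndiff_plus n f g x :
  ndiff n f x -> ndiff n g x -> ndiff n (fun y => f y + g y) x.
Proof.
elim: n f g => [//|n IH] f g [f' [ff fn]] [g' [gg gn]].
exists (fun y => f' y + g' y); split; last exact: IH.
apply: filter_imp (filter_and _ _ ff gg) => y [fy gy].
exact: (is_derive_plus (K:=R_AbsRing) (V:=R_NormedModule)).
Qed.

Lemma ndiff_mult n f g x :
  ndiff n f x -> ndiff n g x -> ndiff n (fun y => f y * g y) x.
Proof.
elim: n f g => [//|n IH] f g fS gS.
have fn := ndiff_pred _ _ _ fS; have gn := ndiff_pred _ _ _ gS.
case: fS => f' [ff f'n]; case: gS => g' [gg g'n].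
exists (fun y => f' y * g y + f y * g' y); split; last by apply: ndiff_plus; apply: IH.
apply: filter_imp (filter_and _ _ ff gg) => y [fy gy].
by apply: (is_derive_mult (K:=R_AbsRing)) => // a b; apply: Rmult_comm.
Qed.

Lemma ndiff_comp n h f x :
  ndiff n h (f x) -> ndiff n f x -> ndiff n (fun y => h (f y)) x.
Proof.
elim: n h f => [//|n IH] h f [h' [hh h'n]] fS.
have fc := ndiff_continuous _ _ _ fS; have fn := ndiff_pred _ _ _ fS.
case: fS => f' [ff f'n].
exists (fun y => f' y * h' (f y)); split.
  apply: filter_imp (filter_and _ _ ff (fc _ hh)) => y [fy hy].
  exact: (is_derive_comp (K:=R_AbsRing) (V:=R_NormedModule)).
by apply: ndiff_mult => //; apply: IH.
Qed.

(** The derivative witnessed by [ndiff] agrees with [Derive f] near [x], so that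
    [Derive_n f (S n)], read as [Derive_n (Derive f) n], may be computed from it. *)
Lemma ndiff_ex_derive_n f n x : ndiff n f x -> ex_derive_n f n x.
Proof.
elim: n f => [//|n IH] f [g [fg gn]].
have Dfg : locally x (fun y => Derive f y = g y).
  by apply: filter_imp fg => y; apply: is_derive_unique.
case: n IH gn => [|n] IH gn.
  by exists (g x); apply: (locally_singleton _ _ fg).
have e (m : nat) : forall y, Derive_n f (S m) y = Derive_n (Derive f) m y.
  by move=> y; rewrite (Derive_n_comp f m 1 y) plusE addn1.
rewrite /ex_derive_n; apply: (ex_derive_ext (Derive_n (Derive f) n)) => [y|].
  by rewrite e.
apply: (ex_derive_n_ext_loc g _ (S n)); last exact: IH.
by apply: filter_imp Dfg => y ->.
Qed.

Lemma smooth_on_Derive U f : smooth_on U f -> smooth_on U (Derive f).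
Proof.
move=> fU n x Ux; case: n => [//|n].
apply: (ex_derive_ext (Derive_n f (S n))); last exact: (fU (S (S n)) x Ux).
by move=> y; rewrite (Derive_n_comp f n 1 y) plusE addn1.
Qed.

Lemma smooth_on_smooth_at (U : R -> Prop) f x :
  open U -> smooth_on U f -> U x -> smooth_at f x.
Proof.
move=> oU fU Ux n; elim: n f fU => [//|n IH] f fU.
exists (Derive f); split; last by apply: IH; apply: smooth_on_Derive.
apply: (filter_imp _ _ _ (oU x Ux)) => y Uy.
by apply: Derive_correct; apply: (fU (S O) y Uy).
Qed.

(** The derivative [- (/ y * / y)] is a product of the function itself, so one
    order of differentiability yields the next. *)
Lemma smooth_at_Rinv x : x <> 0 -> smooth_at Rinv x.
Proof.
move=> x0 n; elim: n => [//|n IH].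
exists (fun y => (-1) * (/ y * / y)); split.
  have nz : locally x (fun y => y <> 0) by exact: open_neq.
  apply: filter_imp nz => y y0.
  by auto_derive => //; field.
by apply: ndiff_mult; [apply: ndiff_const | apply: ndiff_mult].
Qed.

Lemma smooth_at_sqrt x : 0 < x -> smooth_at sqrt x.
Proof.
move=> x0 n; elim: n => [//|n IH].
exists (fun y => / 2 * / sqrt y); split.
  apply: filter_imp (open_gt 0 x x0) => y y0.
  have := sqrt_lt_R0 y y0 => sy.
  by auto_derive => //; field; lra.
apply: ndiff_mult; first exact: ndiff_const.
by apply: (ndiff_comp n Rinv sqrt) => //; apply: smooth_at_Rinv; have := sqrt_lt_R0 x x0; lra.
Qed.

Lemma smooth_at_ln x : 0 < x -> smooth_at ln x.
Proof.
move=> x0 [//|n]; exists Rinv; split; last by apply: smooth_at_Rinv; lra.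
by apply: filter_imp (open_gt 0 x x0) => y; apply: is_derive_ln.
Qed.

(** * Ordinary differential equations in a space of families of reals *)

(** Bounding all coordinates at once, instead of using a norm, treats systems of
    any number of unknowns with scalar integrals. *)
Definition close {I : Type} (d : R) (x y : I -> R) : Prop :=
  forall i, Rabs (x i - y i) <= d.

Definition lipschitz {I : Type} (L : R) (f : (I -> R) -> I -> R) : Prop :=
  forall x y d, close d x y -> close (L * d) (f x) (f y).

Definition lipschitz_near {I : Type} (f : (I -> R) -> I -> R) (x0 : I -> R) : Prop :=
  exists eps L, 0 < eps /\ 0 <= L /\
    forall x y d, close eps x x0 -> close eps y x0 -> close d x y ->
      close (L * d) (f x) (f y).

Definition integral_curve {I : Type} (f : (I -> R) -> I -> R)
    (X : R -> I -> R) (z : R) : Prop :=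
  forall i, is_derive (fun s => X s i) z (f (X z) i).

Lemma close_ge0 {I : Type} (i : I) d (x y : I -> R) : close d x y -> 0 <= d.
Proof. by move=> /(_ i); have := Rabs_pos (x i - y i); lra. Qed.

Lemma le_of_le_geom x y C : (forall n, x <= y + C * (/ 2) ^ n) -> x <= y.
Proof.
move=> h.
have l : is_lim_seq (fun n => y + C * (/ 2) ^ n) (y + C * 0).
  apply: is_lim_seq_plus'; first exact: is_lim_seq_const.
  apply: (is_lim_seq_scal_l _ C 0); apply: is_lim_seq_geom.
  by rewrite Rabs_pos_eq; lra.
have := is_lim_seq_le _ _ _ _ h (is_lim_seq_const x) l.
by rewrite /= Rmult_0_r Rplus_0_r.
Qed.

Lemma eq0_of_le_geom x C : (forall n, Rabs x <= C * (/ 2) ^ n) -> x = 0.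
Proof.
move=> h; apply: Rabs_eq_0; apply: Rle_antisym; last exact: Rabs_pos.
by apply: (le_of_le_geom _ _ C) => n; rewrite Rplus_0_l.
Qed.

Lemma increment_bound g g' c h K :
  (forall y, Rabs (y - c) < h -> is_derive g y (g' y)) ->
  (forall y, Rabs (y - c) < h -> Rabs (g' y) <= K) ->
  forall z, Rabs (z - c) < h -> Rabs (g z - g c) <= K * Rabs (z - c).
Proof.
move=> dg bg z zh.
have inh y : Rmin c z <= y <= Rmax c z -> Rabs (y - c) < h.
  move=> [y1 y2]; apply: Rle_lt_trans zh.
  by move: y1 y2; rewrite /Rmin /Rmax; case: Rle_dec => ? ? ?; split_Rabs; lra.
have [|y yh|y [yh ->]] := MVT_gen g c z g'.
- by move=> y yh; apply: dg; apply: inh; lra.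
- apply/continuity_pt_filterlim; apply: (ex_derive_continuous (V:=R_NormedModule)).
  by exists (g' y); apply: dg; apply: inh.
- rewrite Rabs_mult; apply: Rmult_le_compat_r; first exact: Rabs_pos.
  by apply: bg; apply: inh.
Qed.

(** The indicator function of [P] is locally constant, so its derivative vanishes
    and the mean value theorem makes it constant. *)
Lemma interval_connected (P : R -> Prop) a b z0 :
  a < z0 < b -> P z0 ->
  (forall z, a < z < b -> P z -> locally z P) ->
  (forall z, a < z < b -> ~ P z -> locally z (fun y => ~ P y)) ->
  forall z, a < z < b -> P z.
Proof.
move=> z0ab Pz0 oP oN z zab.
pose g y := if excluded_middle_informative (P y) then 1 else 0.
have dg y : a < y < b -> is_derive g y 0.
  move=> yab; case: (excluded_middle_informative (P y)) => Py.
  - apply: (is_derive_ext_loc (fun _ => 1)); last exact: is_derive_const.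
    by apply: filter_imp (oP y yab Py) => x Px; rewrite /g; case: excluded_middle_informative.
  - apply: (is_derive_ext_loc (fun _ => 0)); last exact: is_derive_const.
    by apply: filter_imp (oN y yab Py) => x Px; rewrite /g; case: excluded_middle_informative.
have inab y : Rmin z0 z <= y <= Rmax z0 z -> a < y < b.
  by rewrite /Rmin /Rmax; case: Rle_dec => ? ?; lra.
have [|y yh|y [_ gg]] := MVT_gen g z0 z (fun _ => 0).
- by move=> y yh; apply: dg; apply: inab; lra.
- apply/continuity_pt_filterlim; apply: (ex_derive_continuous (V:=R_NormedModule)).
  by exists 0; apply: dg; apply: inab.
- move: gg; rewrite /g; destruct (excluded_middle_informative (P z)) => //.
  destruct (excluded_middle_informative (P z0)) => //= gg; lra.
Qed.

Lemma continuous_near_close {I : Type} (X : R -> I -> R) (z eps : R) :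
  continuous (X : R -> fct_UniformSpace I R_UniformSpace) z -> 0 < eps ->
  locally z (fun s => close eps (X s) (X z)).
Proof.
move=> cX e0.
have nX : locally z (fun s => ball (X z : fct_UniformSpace I R_UniformSpace) eps (X s)) :=
  cX _ (locally_ball (X z : fct_UniformSpace I R_UniformSpace) (mkposreal eps e0)).
apply: filter_imp nX => s h i; apply: Rlt_le.
by have := h i; rewrite /ball /= /AbsRing_ball /abs /minus /plus /opp /=.
Qed.

(** On an interval of half-length at most [1 / (2 (L + 1))] around [c], a bound [D] on the
    distance of the two curves improves to [D / 2] by the mean value inequality;
    iterating, the distance is zero. *)
Lemma integral_curve_unique_near {I : Type} f (X Y : R -> I -> R) c :
  locally c (integral_curve f X) -> locally c (integral_curve f Y) ->
  continuous (X : R -> fct_UniformSpace I R_UniformSpace) c ->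
  continuous (Y : R -> fct_UniformSpace I R_UniformSpace) c ->
  lipschitz_near f (X c) -> (forall i, X c i = Y c i) ->
  locally c (fun z => forall i, X z i = Y z i).
Proof.
move=> dX dY cX cY [eps [L [e0 [L0 lip]]]] XY.
have nX := continuous_near_close X c eps cX e0.
have nY := continuous_near_close Y c eps cY e0.
have [[h h0] /= H] := filter_and _ _ (filter_and _ _ dX nX) (filter_and _ _ dY nY).
pose h' := Rmin h (/ (2 * (L + 1))).
have h'0 : 0 < h' by apply: Rmin_pos => //; apply: Rinv_0_lt_compat; lra.
have Lh' : L * h' <= / 2.
  have : h' <= / (2 * (L + 1)) by exact: Rmin_r.
  move=> /(Rmult_le_compat_l L _ _ L0); have : L * / (2 * (L + 1)) <= / 2; last lra.
  apply: (Rmult_le_reg_r (2 * (L + 1))); first lra.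
  by rewrite Rmult_assoc Rinv_l; lra.
have inH z : Rabs (z - c) < h' -> ball c h z.
  by move=> zc; apply: (Rlt_le_trans _ _ _ zc); exact: Rmin_l.
(* The start [2 eps] comes from the triangle inequality: both curves are within [eps]
   of their common value at [c]. *)
have key n z : Rabs (z - c) < h' -> close (2 * eps * (/ 2) ^ n) (X z) (Y z).
  elim: n z => [|n IH] z zh i.
    have [[_ /(_ i) xz] [_ /(_ i) yz]] := H z (inH z zh).
    by move: yz; rewrite -(XY i) /= => yz; split_Rabs; lra.
  set D := 2 * eps * (/ 2) ^ n in IH.
  have D0 : 0 <= D by apply: (close_ge0 i _ _ _ (IH z zh)).
  have dg y : Rabs (y - c) < h' ->
      is_derive (fun s => X s i - Y s i) y (f (X y) i - f (Y y) i).
    move=> /inH /H [[dXy _] [dYy _]].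
    by apply: (is_derive_minus (K:=R_AbsRing) (V:=R_NormedModule)); [exact: dXy | exact: dYy].
  have bg y : Rabs (y - c) < h' -> Rabs (f (X y) i - f (Y y) i) <= L * D.
    move=> yh; have [[_ cXy] [_ cYy]] := H y (inH y yh).
    by apply: (lip (X y) (Y y) D) => //; [move=> j; rewrite (XY j) | exact: IH].
  have := increment_bound _ _ c h' (L * D) dg bg z zh.
  rewrite /= (XY i) => le1.
  have le2 : L * D * Rabs (z - c) <= L * D * h'.
    by apply: Rmult_le_compat_l; [apply: Rmult_le_pos | lra].
  have le3 : D * (L * h') <= D * / 2 by apply: Rmult_le_compat_l.
  rewrite /D in le1 le2 le3 *; rewrite [in X in _ <= X]/=.
  by move: le1; rewrite Rminus_diag Rminus_0_r; lra.
exists (mkposreal h' h'0) => z zh i; apply: Rminus_diag_uniq.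
by apply: (eq0_of_le_geom _ (2 * eps)) => n; apply: key.
Qed.

(** The set of agreement is open by local uniqueness and closed by continuity. *)
Lemma integral_curve_unique {I : Type} f (X Y : R -> I -> R) a b z0 :
  a < z0 < b ->
  (forall z, a < z < b -> integral_curve f X z /\ integral_curve f Y z) ->
  (forall z, a < z < b ->
     continuous (X : R -> fct_UniformSpace I R_UniformSpace) z /\
     continuous (Y : R -> fct_UniformSpace I R_UniformSpace) z) ->
  (forall z, a < z < b -> lipschitz_near f (X z)) ->
  (forall i, X z0 i = Y z0 i) ->
  forall z, a < z < b -> forall i, X z i = Y z i.
Proof.
move=> z0ab dXY cXY lip XY0; apply: (interval_connected _ _ _ _ z0ab XY0) => z zab.
- move=> XYz; have [cX cY] := cXY z zab.
  have oab : locally z (fun s => a < s < b).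
    by apply: filter_and; [apply: open_gt | apply: open_lt]; lra.
  apply: (integral_curve_unique_near f _ _ _ _ _ cX cY (lip z zab) XYz);
    by apply: (filter_imp (fun s => a < s < b) _ _ oab) => s /dXY [].
- move=> /not_all_ex_not [i ni].
  have [dX dY] := dXY z zab.
  have cd : continuous (fun s => X s i - Y s i) z.
    apply: ex_derive_continuous; exists (f (X z) i - f (Y z) i).
    by apply: (is_derive_minus (K:=R_AbsRing) (V:=R_NormedModule)); [exact: dX | exact: dY].
  have nz : X z i - Y z i <> 0 by lra.
  have nzs : locally z (fun s => X s i - Y s i <> 0) := cd _ (open_neq 0 _ nz).
  apply: filter_imp nzs => s ne eqs.
  by apply: ne; rewrite (eqs i); lra.
Qed.

Definition clamp (c rho x : R) : R := Rmax (c - rho) (Rmin (c + rho) x).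

Lemma clamp_id c rho x : Rabs (x - c) <= rho -> clamp c rho x = x.
Proof.
by move=> h; rewrite /clamp /Rmax /Rmin; repeat destruct (Rle_dec _ _); split_Rabs; lra.
Qed.

Lemma clamp_near c rho x : 0 <= rho -> Rabs (clamp c rho x - c) <= rho.
Proof.
by move=> h; rewrite /clamp /Rmax /Rmin; repeat destruct (Rle_dec _ _); split_Rabs; lra.
Qed.

Lemma clamp_contract c rho x y : Rabs (clamp c rho x - clamp c rho y) <= Rabs (x - y).
Proof.
by rewrite /clamp /Rmax /Rmin; repeat destruct (Rle_dec _ _); split_Rabs; lra.
Qed.
(** The sequences [u n - 2 C / 2^n] and [u n + 2 C / 2^n] are adjacent and enclose
    [u n]. *)
Lemma Lim_seq_geom u C :
  0 <= C -> (forall n, Rabs (u (S n) - u n) <= C * (/ 2) ^ n) ->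
  forall n, Rabs (real (Lim_seq u) - u n) <= 2 * C * (/ 2) ^ n.
Proof.
move=> C0 hu n.
pose v n := u n - 2 * C * (/ 2) ^ n; pose w n := u n + 2 * C * (/ 2) ^ n.
have vS m : v m <= v (S m).
  by have := hu m; rewrite /v /=; set q := (/ 2) ^ m; split_Rabs; nra.
have wS m : w (S m) <= w m.
  by have := hu m; rewrite /w /=; set q := (/ 2) ^ m; split_Rabs; nra.
have geo : is_lim_seq (fun n => 2 * C * (/ 2) ^ n) 0.
  rewrite -(Rmult_0_r (2 * C)); apply: (is_lim_seq_scal_l _ (2 * C) 0).
  by apply: is_lim_seq_geom; rewrite Rabs_pos_eq; lra.
have wv : is_lim_seq (fun n => w n - v n) 0.
  apply: (is_lim_seq_ext (fun n => 2 * C * (/ 2) ^ n + 2 * C * (/ 2) ^ n)).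
    by move=> m; rewrite /w /v; ring.
  by rewrite -(Rplus_0_r 0); apply: is_lim_seq_plus'.
have [[lv Hv] [[lw Hw] e]] := ex_lim_seq_adj v w vS wS wv.
have lvw : lv = lw.
  by move: e; rewrite (is_lim_seq_unique _ _ Hv) (is_lim_seq_unique _ _ Hw) => -[].
have Hu : is_lim_seq u lv.
  apply: (is_lim_seq_ext (fun n => v n + 2 * C * (/ 2) ^ n)).
    by move=> m; rewrite /v; ring.
  by rewrite -(Rplus_0_r lv); apply: is_lim_seq_plus'.
rewrite (is_lim_seq_unique _ _ Hu) /=.
have := is_lim_seq_incr_compare _ _ Hv vS n.
have := is_lim_seq_decr_compare _ _ Hw wS n.
by rewrite -lvw /v /w; split_Rabs; lra.
Qed.

Lemma lipschitz_continuous g C :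
  (forall z y, Rabs (g z - g y) <= C * Rabs (z - y)) -> forall z, continuous g z.
Proof.
move=> gl z; apply/filterlim_locally => -[eps e0].
have d0 : 0 < eps / (Rabs C + 1).
  by apply: Rdiv_lt_0_compat => //; have := Rabs_pos C; lra.
exists (mkposreal _ d0) => y.
rewrite /ball /= /AbsRing_ball /abs /minus /plus /opp /= => yz.
apply: Rle_lt_trans (gl y z) _.
have C1 : 0 < Rabs C + 1 by have := Rabs_pos C; lra.
move: yz => /(Rmult_lt_compat_r _ _ _ C1); rewrite /Rdiv Rmult_assoc Rinv_l; last lra.
have := Rle_abs C; have := Rabs_pos (y + - z); rewrite -/(y - z).
by move=> ? ? ?; nra.
Qed.

Lemma abs_RInt_le g K a b :
  (forall s, continuous g s) -> (forall s, Rabs (g s) <= K) ->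
  Rabs (RInt g a b) <= K * Rabs (b - a).
Proof.
move=> cg bg.
have ex c d : ex_RInt g c d.
  by apply: (ex_RInt_continuous (V:=R_CompleteNormedModule)) => s _.
have [ab|ba] := Rle_dec a b.
  by rewrite (Rabs_pos_eq (b - a)) 1?Rmult_comm; [apply: abs_RInt_le_const|lra].
rewrite -(opp_RInt_swap _ _ _ (ex b a)) /opp /= Rabs_Ropp Rabs_minus_sym.
by rewrite (Rabs_pos_eq (a - b)) 1?Rmult_comm; [apply: abs_RInt_le_const => //; lra|lra].
Qed.

Definition lipschitz_curve {I : Type} (K : R) (X : R -> I -> R) : Prop :=
  forall z y, close (K * Rabs (z - y)) (X z) (X y).

Lemma lipschitz_along {I : Type} L K f (X : R -> I -> R) i :
  lipschitz L f -> lipschitz_curve K X -> forall z, continuous (fun s => f (X s) i) z.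
Proof.
move=> lf lX; apply: (lipschitz_continuous _ (L * K)) => z y.
by rewrite Rmult_assoc; apply: lf; apply: lX.
Qed.

(** The upper bound is clamped to the interval on which the map contracts: all
    iterates are then defined and Lipschitz on the whole line, and the contraction
    estimate holds at every time. *)
Definition picard_map {I : Type} (f : (I -> R) -> I -> R) (x0 : I -> R) (z0 h : R)
    (X : R -> I -> R) : R -> I -> R :=
  fun z i => x0 i + RInt (fun s => f (X s) i) z0 (clamp z0 h z).

Lemma picard_map_lipschitz {I : Type} L K K' f x0 z0 h (X : R -> I -> R) :
  lipschitz L f -> (forall x i, Rabs (f x i) <= K) -> lipschitz_curve K' X ->
  lipschitz_curve K (picard_map f x0 z0 h X).
Proof.
move=> lf bf lX z y i.
have cf := lipschitz_along L K' f X i lf lX.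
have ex c d : ex_RInt (fun s => f (X s) i) c d.
  by apply: (ex_RInt_continuous (V:=R_CompleteNormedModule)) => s _.
have K0 : 0 <= K by apply: Rle_trans (Rabs_pos _) (bf x0 i).
rewrite /picard_map.
have := RInt_Chasles _ _ _ _ (ex z0 (clamp z0 h y)) (ex (clamp z0 h y) (clamp z0 h z)).
rewrite /plus /= => <-.
set p := RInt _ z0 _; set q := RInt _ (clamp z0 h y) _.
have -> : x0 i + (p + q) - (x0 i + p) = q by ring.
apply: Rle_trans (abs_RInt_le _ K _ _ cf (fun s => bf (X s) i)) _.
by apply: Rmult_le_compat_l => //; apply: clamp_contract.
Qed.

Lemma picard_map_contract {I : Type} L K f x0 z0 h D (X Y : R -> I -> R) :
  0 <= L -> 0 <= h -> lipschitz L f -> lipschitz_curve K X -> lipschitz_curve K Y ->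
  (forall z, close D (X z) (Y z)) ->
  forall z, close (L * h * D) (picard_map f x0 z0 h X z) (picard_map f x0 z0 h Y z).
Proof.
move=> L0 h0 lf lX lY XY z i.
have cX := lipschitz_along L K f X i lf lX.
have cY := lipschitz_along L K f Y i lf lY.
have ex (Z : R -> I -> R) c d : (forall z, continuous (fun s => f (Z s) i) z) ->
    ex_RInt (fun s => f (Z s) i) c d.
  by move=> cZ; apply: (ex_RInt_continuous (V:=R_CompleteNormedModule)) => s _.
rewrite /picard_map.
have -> (p q : R) : x0 i + p - (x0 i + q) = p - q by ring.
have := RInt_minus _ _ _ _ (ex X z0 (clamp z0 h z) cX) (ex Y z0 (clamp z0 h z) cY).
rewrite /minus /plus /opp /= /Rminus => <-.
apply: Rle_trans (abs_RInt_le _ (L * D) _ _ _ _) _ => [s|s|].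
- exact: (continuous_minus (K:=R_AbsRing) (V:=R_NormedModule)).
- by apply: lf; apply: XY.
- have D0 := close_ge0 i _ _ _ (XY z).
  have := clamp_near z0 h z h0; rewrite -/(Rminus _ _) => cl.
  have := Rmult_le_compat_l (L * D) _ _ (Rmult_le_pos _ _ L0 D0) cl.
  by lra.
Qed.

(** With [L h <= 1/2] the iterates converge geometrically at each time.  As they
    are all [K]-Lipschitz, so is the limit; its continuity therefore needs no
    uniform convergence, and the fixed point equation follows from the
    contraction estimate between the limit and the iterates. *)
Lemma picard_lipschitz {I : Type} L K f (x0 : I -> R) z0 :
  0 <= L -> 0 <= K -> lipschitz L f -> (forall x i, Rabs (f x i) <= K) ->
  exists (h : R) (X : R -> I -> R), 0 < h /\ (forall i, X z0 i = x0 i) /\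
    lipschitz_curve K X /\ forall z, Rabs (z - z0) < h -> integral_curve f X z.
Proof.
move=> L0 K0 lf bf.
pose h := / (2 * (L + 1)).
have h0 : 0 < h by apply: Rinv_0_lt_compat; lra.
have Lh : L * h <= / 2.
  apply: (Rmult_le_reg_r (2 * (L + 1))); first lra.
  by rewrite /h Rmult_assoc Rinv_l; lra.
pose T := picard_map f x0 z0 h.
pose u n := Nat.iter n T (fun _ => x0).
have ul n : lipschitz_curve K (u n).
  elim: n => [|n IH]; last exact: (picard_map_lipschitz L K K _ _ _ _ _ lf bf IH).
  move=> z y i; rewrite /u /= Rminus_diag Rabs_R0.
  by apply: Rmult_le_pos => //; apply: Rabs_pos.
have du n : forall z, close (K * h * (/ 2) ^ n) (u (S n) z) (u n z).
  elim: n => [|n IH] z i.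
    rewrite /u /= /T /picard_map.
    have -> (p : R) : x0 i + p - x0 i = p by ring.
    have cc s : continuous (fun _ : R => f x0 i) s by exact: continuous_const.
    apply: Rle_trans (abs_RInt_le _ K _ _ cc (fun _ => bf x0 i)) _.
    by rewrite Rmult_1_r; apply: Rmult_le_compat_l => //; apply: clamp_near; lra.
  have := picard_map_contract L K f x0 z0 h _ _ _ L0 (Rlt_le _ _ h0) lf (ul _) (ul _) IH z i.
  have D0 := close_ge0 i _ _ _ (IH z).
  move=> le; apply: Rle_trans le _.
  by have := Rmult_le_compat_r _ _ _ D0 Lh => /=; lra.
pose X z i := real (Lim_seq (fun n => u n z i)).
pose C := 2 * (K * h).
have Xu n z : close (C * (/ 2) ^ n) (X z) (u n z).
  move=> i; apply: (Lim_seq_geom (fun n => u n z i) (K * h)) => [|m]; last exact: du.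
  by apply: Rmult_le_pos; lra.
have Xl : lipschitz_curve K X.
  move=> z y i; apply: (le_of_le_geom _ _ (2 * C)) => n.
  by have := Xu n z i; have := Xu n y i; have := ul n z y i; split_Rabs; lra.
have Xfix z i : X z i = T X z i.
  apply: Rminus_diag_uniq; apply: (eq0_of_le_geom _ C) => n.
  have c1 := Xu (S n) z i.
  have c2 := picard_map_contract L K f x0 z0 h _ _ _ L0 (Rlt_le _ _ h0) lf Xl (ul n) (Xu n) z i.
  have D0 := close_ge0 i _ _ _ (Xu n z).
  have c3 := Rmult_le_compat_r _ _ _ D0 Lh.
  move: c1 c2 c3; rewrite -/T.
  have -> : u (S n) z i = T (u n) z i by [].
  by rewrite /=; split_Rabs; lra.
exists h, X; split=> //; split=> [i|].
  rewrite Xfix /T /picard_map clamp_id; last by rewrite Rminus_diag Rabs_R0; lra.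
  by rewrite RInt_point /zero /= Rplus_0_r.
split=> // z zh i.
have cX := lipschitz_along L K f X i lf Xl.
apply: (is_derive_ext_loc (fun s => x0 i + RInt (fun s => f (X s) i) z0 s)).
  have nz : locally z (fun s => Rabs (s - z0) < h).
    have d0 : 0 < h - Rabs (z - z0) by lra.
    exists (mkposreal _ d0) => s.
    by rewrite /ball /= /AbsRing_ball /abs /minus /plus /opp /= => ?; split_Rabs; lra.
  by apply: filter_imp nz => s sh; rewrite Xfix /T /picard_map clamp_id //; lra.
have -> : f (X z) i = plus zero (f (X z) i) by rewrite plus_zero_l.
apply: (is_derive_plus (K:=R_AbsRing) (V:=R_NormedModule)); first exact: is_derive_const.
apply: (is_derive_RInt (V:=R_NormedModule)) (cX z).
apply: filter_forall => s; apply: RInt_correct.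
by apply: (ex_RInt_continuous (V:=R_CompleteNormedModule)) => y _.
Qed.

(** Clamping each coordinate of the argument to the box where [f] is Lipschitz
    gives a globally Lipschitz and bounded field; its solution, being
    Lipschitz, remains in the box for a short time, where clamping has no effect. *)
Lemma picard_lindelof {I : Type} f (x0 : I -> R) z0 :
  lipschitz_near f x0 -> (exists K, forall i, Rabs (f x0 i) <= K) ->
  exists (h K : R) (X : R -> I -> R), 0 < h /\ (forall i, X z0 i = x0 i) /\
    lipschitz_curve K X /\ forall z, Rabs (z - z0) < h -> integral_curve f X z.
Proof.
move=> [eps [L [e0 [L0 lip]]]] [K bK].
pose c x i := clamp (x0 i) eps (x i).
have cn x : close eps (c x) x0 by move=> i; apply: clamp_near; lra.
have lc x y d : close d x y -> close d (c x) (c y).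
  by move=> xy i; apply: Rle_trans (xy i); apply: clamp_contract.
pose K' := Rmax 0 (K + L * eps).
have [] := picard_lipschitz L K' (fun x => f (c x)) x0 z0 L0 (Rmax_l _ _).
- by move=> x y d xy; apply: lip => //; apply: lc.
- move=> x i; apply: Rle_trans (Rmax_r _ _).
  have x0x0 : close eps x0 x0 by move=> j; rewrite Rminus_diag Rabs_R0; lra.
  have := lip (c x) x0 eps (cn x) x0x0 (cn x) i.
  by have := bK i; split_Rabs; lra.
move=> h [X [h0 [X0 [Xl dX]]]].
pose h' := Rmin h (eps / (K' + 1)).
have K'0 : 0 <= K' by apply: Rmax_l.
have h'0 : 0 < h' by apply: Rmin_pos => //; apply: Rdiv_lt_0_compat => //; lra.
exists h', K', X; split=> //; split=> //; split=> // z zh.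
have zh1 : Rabs (z - z0) < h by apply: Rlt_le_trans zh (Rmin_l _ _).
have zh2 : Rabs (z - z0) < eps / (K' + 1) by apply: Rlt_le_trans zh (Rmin_r _ _).
have cX i : c (X z) i = X z i.
  apply: clamp_id; rewrite -X0; apply: Rle_trans (Xl z z0 i) _.
  have K1 : 0 < K' + 1 by lra.
  move: zh2 => /(Rmult_lt_compat_r _ _ _ K1); rewrite /Rdiv Rmult_assoc Rinv_l; last lra.
  by have := Rabs_pos (z - z0); nra.
move=> i; have := dX z zh1 i.
by rewrite (functional_extensionality (c (X z)) (X z) cX).
Qed.

(** * Terms built from smooth functions *)

Definition finite_index (I : Type) : Prop := exists s : seq I, forall i, List.In i s.

(** Used with neighbourhoods, with small radii and with large constants, to make
    these uniform over the coordinates. *)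
Lemma filter_finite {I T : Type} (Fl : (T -> Prop) -> Prop) {FF : Filter Fl}
    (P : I -> T -> Prop) :
  finite_index I -> (forall i, Fl (P i)) -> Fl (fun t => forall i, P i t).
Proof.
move=> [s sI] FP.
have : Fl (fun t => forall i, List.In i s -> P i t).
  elim: {sI} s => [|j s IH]; first by apply: filter_forall.
  by apply: filter_imp (filter_and _ _ (FP j) IH) => t [Pj Ps] i [<-|/Ps].
by apply: filter_imp => t Pt i; apply: Pt.
Qed.

Lemma locally_close {I : Type} (x0 : I -> R) (P : (I -> R) -> Prop) :
  locally (x0 : fct_UniformSpace I R_UniformSpace) P <->
  exists eps, 0 < eps /\ forall x, close eps x x0 -> P x.
Proof.
split=> [[[e e0] He]|[e [e0 He]]].
  exists (e / 2); split=> [|x xe]; first lra.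
  apply: He => i; have := xe i.
  by rewrite /ball /= /AbsRing_ball /abs /minus /plus /opp /= -/(Rminus _ _); lra.
exists (mkposreal e e0) => x xe; apply: He => i; apply: Rlt_le; exact: xe.
Qed.

Lemma continuous_index {I : Type} (X : R -> I -> R) z :
  finite_index I -> (forall i, continuous (fun s => X s i) z) ->
  continuous (X : R -> fct_UniformSpace I R_UniformSpace) z.
Proof.
move=> fI cX; apply/filterlim_locally => eps.
apply: (filter_finite (locally z) (fun i s => ball (X z i) eps (X s i)) fI) => i.
by have /filterlim_locally := cX i; apply.
Qed.

Definition scalar_lipschitz {I : Type} (eps L : R) (f : (I -> R) -> R) (x0 : I -> R) : Prop :=
  forall x y d, close eps x x0 -> close eps y x0 -> close d x y ->
    Rabs (f x - f y) <= L * d.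

Lemma scalar_lipschitz_sub {I : Type} eps eps' L (f : (I -> R) -> R) x0 :
  eps' <= eps -> scalar_lipschitz eps L f x0 -> scalar_lipschitz eps' L f x0.
Proof.
by move=> le fL x y d x0x y0y; apply: fL => i;
  [have := x0x i | have := y0y i]; lra.
Qed.

Lemma scalar_lipschitz_bound {I : Type} eps L (f : (I -> R) -> R) x0 x :
  0 <= eps -> scalar_lipschitz eps L f x0 -> close eps x x0 ->
  Rabs (f x - f x0) <= L * eps.
Proof.
move=> e0 fL xe; apply: fL => // i.
by rewrite Rminus_diag Rabs_R0.
Qed.

(** The derivative is itself differentiable, hence continuous, hence bounded near
    [p]. *)
Lemma smooth_at_lipschitz h p : smooth_at h p ->
  exists rho L, 0 < rho /\ 0 <= L /\ forall x y, Rabs (x - p) <= rho ->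
    Rabs (y - p) <= rho -> Rabs (h x - h y) <= L * Rabs (x - y).
Proof.
move=> /(_ (S (S O))) [g [hg gS]].
have cg := ndiff_continuous O _ _ gS.
have gb : locally p (fun y => ball (g p) 1 (g y)).
  exact: (cg _ (locally_ball (g p) (mkposreal 1 Rlt_0_1))).
have [[e e0] /= He] := filter_and _ _ hg gb.
(* Points [x], [y] within [e / 4] of [p] are at distance at most [e / 2], and the ball of
   radius [3 e / 4] around [y] remains inside the ball of radius [e] around [p]. *)
exists (e / 4), (Rabs (g p) + 1); split; first lra.
split=> [|x y xp yp]; first by have := Rabs_pos (g p); lra.
have inb s : Rabs (s - y) < e * (3 / 4) -> ball p e s.
  by rewrite /ball /= /AbsRing_ball /abs /minus /plus /opp /=; split_Rabs; lra.
apply: (increment_bound h g y (e * (3 / 4))) => [s /inb /He [] //|s /inb /He [_]|].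
  rewrite /ball /= /AbsRing_ball /abs /minus /plus /opp /=; split_Rabs; lra.
by split_Rabs; lra.
Qed.

(** A syntax-like substitute for smooth functions of several variables, relative to
    a base point: only functions of one variable have to be known smooth.
    Closure under local equality lets a function defined by derivatives of
    integrals be replaced by its closed form, valid near the base point only. *)
Inductive smooth_term {I : Type} (x0 : I -> R) : ((I -> R) -> R) -> Prop :=
| term_const c : smooth_term x0 (fun _ => c)
| term_coord i : smooth_term x0 (fun x => x i)
| term_plus f g : smooth_term x0 f -> smooth_term x0 g -> smooth_term x0 (fun x => f x + g x)
| term_mult f g : smooth_term x0 f -> smooth_term x0 g -> smooth_term x0 (fun x => f x * g x)
| term_comp h f : smooth_at h (f x0) -> smooth_term x0 f -> smooth_term x0 (fun x => h (f x))
| term_ext f g : locally (x0 : fct_UniformSpace I R_UniformSpace) (fun x => f x = g x) ->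
    smooth_term x0 f -> smooth_term x0 g.

Lemma term_opp {I : Type} (x0 : I -> R) f :
  smooth_term x0 f -> smooth_term x0 (fun x => - f x).
Proof.
move=> tf; apply: (term_ext _ (fun x => -1 * f x)).
  by apply: filter_forall => x; ring.
by apply: term_mult => //; apply: term_const.
Qed.

Lemma term_minus {I : Type} (x0 : I -> R) f g :
  smooth_term x0 f -> smooth_term x0 g -> smooth_term x0 (fun x => f x - g x).
Proof. by move=> tf tg; apply: term_plus => //; apply: term_opp. Qed.

Lemma term_inv {I : Type} (x0 : I -> R) f :
  f x0 <> 0 -> smooth_term x0 f -> smooth_term x0 (fun x => / f x).
Proof. by move=> f0; apply: (term_comp _ Rinv); apply: smooth_at_Rinv. Qed.

Lemma term_div {I : Type} (x0 : I -> R) f g :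
  g x0 <> 0 -> smooth_term x0 f -> smooth_term x0 g -> smooth_term x0 (fun x => f x / g x).
Proof. by move=> g0 tf tg; apply: term_mult => //; apply: term_inv. Qed.

Lemma term_sqrt {I : Type} (x0 : I -> R) f :
  0 < f x0 -> smooth_term x0 f -> smooth_term x0 (fun x => sqrt (f x)).
Proof. by move=> f0; apply: (term_comp _ sqrt); apply: smooth_at_sqrt. Qed.

Lemma term_ln {I : Type} (x0 : I -> R) f :
  0 < f x0 -> smooth_term x0 f -> smooth_term x0 (fun x => ln (f x)).
Proof. by move=> f0; apply: (term_comp _ ln); apply: smooth_at_ln. Qed.

Lemma term_pow {I : Type} (x0 : I -> R) f n :
  smooth_term x0 f -> smooth_term x0 (fun x => f x ^ n).
Proof.
by move=> tf; elim: n => [|n IH]; [apply: term_const | apply: term_mult].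
Qed.

(** In the composition case the radius is reduced so that the values of the inner
    term stay where the outer function is Lipschitz. *)
Lemma smooth_term_lipschitz {I : Type} (x0 : I -> R) f : smooth_term x0 f ->
  exists eps L, 0 < eps /\ 0 <= L /\ scalar_lipschitz eps L f x0.
Proof.
elim=> {f}.
- move=> c; exists 1, 0; split; [lra | split; first lra].
  by move=> x y d _ _ _; rewrite Rminus_diag Rabs_R0; lra.
- move=> i; exists 1, 1; split; [lra | split; first lra].
  by move=> x y d _ _ xy; have := xy i; lra.
- move=> f g _ [e1 [L1 [e10 [L10 fL]]]] _ [e2 [L2 [e20 [L20 gL]]]].
  exists (Rmin e1 e2), (L1 + L2); split; first exact: Rmin_pos.
  split=> [|x y d xe ye xy]; first lra.
  have := scalar_lipschitz_sub _ _ _ _ _ (Rmin_l e1 e2) fL x y d xe ye xy.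
  have := scalar_lipschitz_sub _ _ _ _ _ (Rmin_r e1 e2) gL x y d xe ye xy.
  by split_Rabs; lra.
- move=> f g _ [e1 [L1 [e10 [L10 fL]]]] _ [e2 [L2 [e20 [L20 gL]]]].
  pose e := Rmin e1 e2.
  have e0 : 0 < e by exact: Rmin_pos.
  have {}fL := scalar_lipschitz_sub _ _ _ _ _ (Rmin_l e1 e2) fL.
  have {}gL := scalar_lipschitz_sub _ _ _ _ _ (Rmin_r e1 e2) gL.
  pose bf := Rabs (f x0) + L1 * e; pose bg := Rabs (g x0) + L2 * e.
  have bf0 : 0 <= bf.
    by apply: Rplus_le_le_0_compat; [exact: Rabs_pos | apply: Rmult_le_pos; lra].
  have bg0 : 0 <= bg.
    by apply: Rplus_le_le_0_compat; [exact: Rabs_pos | apply: Rmult_le_pos; lra].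
  exists e, (bf * L2 + bg * L1); split=> //; split=> [|x y d xe ye xy].
    by apply: Rplus_le_le_0_compat; apply: Rmult_le_pos.
  have f1 := fL x y d xe ye xy; have g1 := gL x y d xe ye xy.
  have f2 : Rabs (f x) <= bf.
    have := scalar_lipschitz_bound _ _ _ _ _ (Rlt_le _ _ e0) fL xe.
    by rewrite /bf; split_Rabs; lra.
  have g2 : Rabs (g y) <= bg.
    have := scalar_lipschitz_bound _ _ _ _ _ (Rlt_le _ _ e0) gL ye.
    by rewrite /bg; split_Rabs; lra.
  have -> : f x * g x - f y * g y = f x * (g x - g y) + g y * (f x - f y) by ring.
  apply: Rle_trans (Rabs_triang _ _) _; rewrite !Rabs_mult.
  have := Rmult_le_compat _ _ _ _ (Rabs_pos _) (Rabs_pos _) f2 g1.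
  have := Rmult_le_compat _ _ _ _ (Rabs_pos _) (Rabs_pos _) g2 f1.
  by lra.
- move=> h f /smooth_at_lipschitz [rho [Lh [rho0 [Lh0 hL]]]] _ [e [L [e0 [L0 fL]]]].
  pose e' := Rmin e (rho / (L + 1)).
  have e'0 : 0 < e' by apply: Rmin_pos => //; apply: Rdiv_lt_0_compat => //; lra.
  have {}fL := scalar_lipschitz_sub _ _ _ _ _ (Rmin_l e (rho / (L + 1))) fL.
  have Le' : L * e' <= rho.
    have L1 : 0 < L + 1 by lra.
    have : e' <= rho / (L + 1) by exact: Rmin_r.
    move=> /(Rmult_le_compat_r _ _ _ (Rlt_le _ _ L1)).
    by rewrite /Rdiv Rmult_assoc Rinv_l; [lra | lra].
  exists e', (Lh * L); split=> //; split=> [|x y d xe ye xy]; first exact: Rmult_le_pos.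
  have bx := scalar_lipschitz_bound _ _ _ _ _ (Rlt_le _ _ e'0) fL xe.
  have b_y := scalar_lipschitz_bound _ _ _ _ _ (Rlt_le _ _ e'0) fL ye.
  apply: Rle_trans (hL _ _ (Rle_trans _ _ _ bx Le') (Rle_trans _ _ _ b_y Le')) _.
  by rewrite Rmult_assoc; apply: Rmult_le_compat_l => //; apply: fL.
- move=> f g /locally_close [e1 [e10 fg]] _ [e2 [L [e20 [L0 fL]]]].
  exists (Rmin e1 e2), L; split; first exact: Rmin_pos.
  split=> // x y d xe ye xy.
  have sub z : close (Rmin e1 e2) z x0 -> close e1 z x0.
    by move=> ze i; apply: Rle_trans (ze i) (Rmin_l _ _).
  rewrite -(fg x (sub x xe)) -(fg y (sub y ye)).
  exact: (scalar_lipschitz_sub _ _ _ _ _ (Rmin_r e1 e2) fL x y d xe ye xy).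
Qed.

Lemma smooth_term_continuous {I : Type} (x0 : I -> R) f : smooth_term x0 f ->
  continuous (f : fct_UniformSpace I R_UniformSpace -> R) x0.
Proof.
move=> /smooth_term_lipschitz [e [L [e0 [L0 fL]]]].
apply/filterlim_locally => -[r r0]; apply/locally_close.
pose e' := Rmin e (r / (L + 1)).
have e'0 : 0 < e' by apply: Rmin_pos => //; apply: Rdiv_lt_0_compat => //; lra.
exists e'; split=> // x xe.
have L1 : 0 < L + 1 by lra.
have : e' <= r / (L + 1) by exact: Rmin_r.
move=> /(Rmult_le_compat_r _ _ _ (Rlt_le _ _ L1)).
rewrite /Rdiv Rmult_assoc Rinv_l; last lra.
have := scalar_lipschitz_bound _ _ _ _ _ (Rlt_le _ _ e'0)
  (scalar_lipschitz_sub _ _ _ _ _ (Rmin_l e (r / (L + 1))) fL) xe.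
by rewrite /ball /= /AbsRing_ball /abs /minus /plus /opp /= -/(Rminus _ _); lra.
Qed.

Lemma smooth_term_gt0 {I : Type} (x0 : I -> R) f : smooth_term x0 f -> 0 < f x0 ->
  locally (x0 : fct_UniformSpace I R_UniformSpace) (fun x => 0 < f x).
Proof. by move=> /smooth_term_continuous cf f0; apply: (cf _ (open_gt 0 _ f0)). Qed.

Lemma smooth_term_neq0 {I : Type} (x0 : I -> R) f : smooth_term x0 f -> f x0 <> 0 ->
  locally (x0 : fct_UniformSpace I R_UniformSpace) (fun x => f x <> 0).
Proof. by move=> /smooth_term_continuous cf f0; apply: (cf _ (open_neq 0 _ f0)). Qed.

(** Finiteness of the index type allows a common radius, and then a common
    constant, to be chosen for all components. *)
Lemma smooth_term_lipschitz_near {I : Type} (x0 : I -> R) (f : (I -> R) -> I -> R) :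
  finite_index I -> (forall i, smooth_term x0 (fun x => f x i)) -> lipschitz_near f x0.
Proof.
move=> fI tf.
have : at_right 0 (fun e => forall i, exists L, scalar_lipschitz e L (fun x => f x i) x0).
  apply: filter_finite => // i.
  have [e [L [e0 [L0 fL]]]] := smooth_term_lipschitz _ _ (tf i).
  exists (mkposreal e e0) => r.
  rewrite /ball /= /AbsRing_ball /abs /minus /plus /opp /= => re r0; exists L.
  by apply: scalar_lipschitz_sub fL; split_Rabs; lra.
move=> [[e e0] /= He].
have e2 : 0 < e / 2 by lra.
have be : ball 0 e (e / 2).
  by rewrite /ball /= /AbsRing_ball /abs /minus /plus /opp /=; split_Rabs; lra.
have : Rbar_locally p_infty
    (fun L => forall i, scalar_lipschitz (e / 2) L (fun x => f x i) x0).
  apply: filter_finite => // i.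
  have [L fL] := He (e / 2) be e2 i.
  exists L => L' LL' x y d xe ye xy; apply: Rle_trans (fL x y d xe ye xy) _.
  by apply: Rmult_le_compat_r; [apply: (close_ge0 i _ _ _ xy) | lra].
move=> [L HL]; have := Rmax_l 0 (L + 1); have := Rmax_r 0 (L + 1).
set L' := Rmax _ _ => h1 h2.
exists (e / 2), L'; split=> //; split=> // x y d xe ye xy i.
by apply: (HL L') => //; lra.
Qed.

(** Continuity of the curve for the uniform topology on families is what transports
    the local equalities of [term_ext] to the parameter. *)
Lemma smooth_term_ndiff {I : Type} n (X : R -> I -> R) z f :
  smooth_term (X z) f ->
  continuous (X : R -> fct_UniformSpace I R_UniformSpace) z ->
  (forall i, ndiff n (fun s => X s i) z) -> ndiff n (fun s => f (X s)) z.
Proof.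
move=> tf cX nX; elim: tf => {f}.
- by move=> c; apply: ndiff_const.
- by move=> i; apply: nX.
- by move=> f g _ nf _ ng; apply: ndiff_plus.
- by move=> f g _ nf _ ng; apply: ndiff_mult.
- by move=> h f hs _ nf; apply: ndiff_comp.
- by move=> f g fg _; apply: ndiff_ext; apply: (cX _ fg).
Qed.

(** * Local smooth flow of a vector field of smooth terms *)

(** Smoothness is by bootstrap: if a solution is [n] times differentiable, so is the
    field along it, which is its derivative. *)
Theorem local_flow {I : Type} (f : (I -> R) -> I -> R) (D : (I -> R) -> Prop) x0 z0 :
  finite_index I ->
  (forall x, D x -> locally (x : fct_UniformSpace I R_UniformSpace) D) ->
  (forall x, D x -> forall i, smooth_term x (fun y => f y i)) ->
  D x0 ->
  exists a b, a < z0 < b /\ exists X : R -> I -> R,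
    (forall i, X z0 i = x0 i) /\
    (forall z, a < z < b ->
       D (X z) /\ integral_curve f X z /\ forall i, smooth_at (fun s => X s i) z) /\
    (forall Y : R -> I -> R,
       (forall z, a < z < b -> D (Y z) /\ integral_curve f Y z) ->
       (forall i, Y z0 i = x0 i) ->
       forall z, a < z < b -> forall i, Y z i = X z i).
Proof.
move=> fI oD tf Dx0.
have lf x : D x -> lipschitz_near f x.
  by move=> Dx; apply: smooth_term_lipschitz_near => //; apply: tf.
have bf : exists K, forall i, Rabs (f x0 i) <= K.
  have : Rbar_locally p_infty (fun K => forall i, Rabs (f x0 i) <= K).
    apply: filter_finite => // i; exists (Rabs (f x0 i)) => K; exact: Rlt_le.
  by move=> [K HK]; exists (K + 1); apply: HK; lra.
have [h [K [X [h0 [X0 [Xl dX]]]]]] := picard_lindelof f x0 z0 (lf x0 Dx0) bf.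
have cX z : continuous (X : R -> fct_UniformSpace I R_UniformSpace) z.
  apply: continuous_index => // i.
  by apply: (lipschitz_continuous _ K) => s y; apply: Xl.
have X0e : X z0 = x0 by exact: functional_extensionality.
have DX : locally z0 (fun z => D (X z)).
  by apply: (cX z0 D); rewrite X0e; apply: oD.
case: DX => -[e e0] /= He.
pose r := Rmin h e.
have r0 : 0 < r by exact: Rmin_pos.
have inr z : z0 - r < z < z0 + r -> Rabs (z - z0) < h /\ D (X z).
  have := Rmin_l h e; have := Rmin_r h e; rewrite -/r => re rh zr; split.
    by split_Rabs; lra.
  apply: He; rewrite /ball /= /AbsRing_ball /abs /minus /plus /opp /=.
  by split_Rabs; lra.
exists (z0 - r), (z0 + r); split; first lra.
have near z : z0 - r < z < z0 + r -> locally z (fun s => z0 - r < s < z0 + r).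
  by move=> zr; apply: filter_and; [apply: open_gt | apply: open_lt]; lra.
exists X; split=> //; split=> [z zr|Y dY Y0].
  have [zh Dz] := inr z zr; split=> //; split; first exact: dX.
  move=> i n; elim: n i z zr {zh Dz} => [//|n IH] i z zr.
  exists (fun s => f (X s) i); split.
    by apply: filter_imp (near z zr) => s /inr [sh _]; apply: dX.
  apply: (smooth_term_ndiff n X z (fun x => f x i)) => //.
    by apply: tf; apply: (proj2 (inr z zr)).
  by move=> j; apply: IH.
move=> z zr i; apply: (integral_curve_unique f Y X (z0 - r) (z0 + r) z0) => //.
- lra.
- by move=> s sr; split; [apply: (proj2 (dY s sr)) | apply: dX; apply: (proj1 (inr s sr))].
- move=> s sr; split=> //; apply: continuous_index => // j.
  apply: ex_derive_continuous; exists (f (Y s) j); exact: (proj2 (dY s sr)).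
- by move=> s sr; apply: lf; apply: (proj1 (dY s sr)).
- by move=> j; rewrite Y0 X0.
Qed.

(** * Closed form of J and its partial derivatives *)

Definition admissible (tau M E : R) : Prop := 0 < tau /\ 0 < E /\ 0 < tau * E + M.

(** A primitive in [tau] of [sqrt (tau / (tau E + M))]; unlike the usual
    parametrisations it requires no case distinction on the sign of [M]. *)
Definition prim (tau M E : R) : R :=
  sqrt (tau * (tau * E + M)) / E
  - M / (E * sqrt E) * ln (sqrt (tau * E) + sqrt (tau * E + M)).

Definition prim_M (tau M E : R) : R :=
  tau / (2 * sqrt (tau * (tau * E + M)) * E)
  - / (E * sqrt E) * ln (sqrt (tau * E) + sqrt (tau * E + M))
  - M / (E * sqrt E) * / (2 * sqrt (tau * E + M)) / (sqrt (tau * E) + sqrt (tau * E + M)).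

Definition prim_E (tau M E : R) : R :=
  tau * tau / (2 * sqrt (tau * (tau * E + M)) * E) - sqrt (tau * (tau * E + M)) / (E * E)
  + M * (sqrt E + E / (2 * sqrt E)) / (E * sqrt E * (E * sqrt E))
    * ln (sqrt (tau * E) + sqrt (tau * E + M))
  - M / (E * sqrt E) * (tau / (2 * sqrt (tau * E)) + tau / (2 * sqrt (tau * E + M)))
    / (sqrt (tau * E) + sqrt (tau * E + M)).

Lemma admissible_sqrt tau M E : admissible tau M E ->
  0 < tau * E /\ 0 < tau * (tau * E + M) /\ 0 < sqrt tau /\ 0 < sqrt E /\
  0 < sqrt (tau * E) /\ 0 < sqrt (tau * E + M) /\ 0 < sqrt (tau * (tau * E + M)).
Proof.
move=> [t0 [E0 m0]].
have h1 : 0 < tau * E by exact: Rmult_lt_0_compat.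
have h2 : 0 < tau * (tau * E + M) by exact: Rmult_lt_0_compat.
by do ! split => //; apply: sqrt_lt_R0.
Qed.

(** With [a], [e], [v] the square roots of [tau], [E] and [tau E + M], the claim is a
    rational identity in which [M = v^2 - a^2 e^2]. *)
Lemma is_derive_prim tau M E : admissible tau M E ->
  is_derive (fun x => prim x M E) tau (sqrt (tau / (tau * E + M))).
Proof.
move=> adm; have [h1 [h2 [h3 [h4 [h5 [h6 h7]]]]]] := admissible_sqrt _ _ _ adm.
case: adm => t0 [E0 m0]; rewrite /prim; auto_derive.
  by do ! split => //; lra.
rewrite sqrt_div //; last lra.
rewrite !sqrt_mult in h5 h7 |- *; try lra.
have := sqrt_sqrt tau (Rlt_le _ _ t0); have := sqrt_sqrt E (Rlt_le _ _ E0).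
have := sqrt_sqrt (tau * E + M) (Rlt_le _ _ m0).
move: h3 h4 h6; set a := sqrt tau; set e := sqrt E; set v := sqrt (_ + _).
move=> a0 e0 v0 vv ee aa.
have eM : M = v * v - a * a * (e * e) by rewrite vv ee aa; ring.
rewrite eM -ee -aa; field.
have : 0 < a * e by exact: Rmult_lt_0_compat.
by do ! split; lra.
Qed.

Lemma is_derive_prim_M tau M E : admissible tau M E ->
  is_derive (fun m => prim tau m E) M (prim_M tau M E).
Proof.
move=> adm; have [h1 [h2 [h3 [h4 [h5 [h6 h7]]]]]] := admissible_sqrt _ _ _ adm.
case: adm => t0 [E0 m0]; rewrite /prim /prim_M; auto_derive.
  by do ! split => //; lra.
by field; do ! split; lra.
Qed.

Lemma is_derive_prim_E tau M E : admissible tau M E ->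
  is_derive (fun y => prim tau M y) E (prim_E tau M E).
Proof.
move=> adm; have [h1 [h2 [h3 [h4 [h5 [h6 h7]]]]]] := admissible_sqrt _ _ _ adm.
case: adm => t0 [E0 m0]; rewrite /prim /prim_E; auto_derive.
  by do ! split => //; nra.
by field; do ! split; lra.
Qed.
Lemma region_admissible Ra Ra0 M E t :
  region Ra Ra0 M E t <-> admissible Ra M E /\ admissible Ra0 M E /\ 0 < t.
Proof.
have eq x : 0 < x -> (0 < E + M / x <-> 0 < x * E + M).
  move=> x0; have -> : x * E + M = x * (E + M / x) by field; lra.
  split=> h; first exact: Rmult_lt_0_compat.
  by apply: (Rmult_lt_reg_l x) => //; rewrite Rmult_0_r.
rewrite /region /admissible; split.
  move=> [h1 [h2 [h3 [h4 [/(eq _ h1) h5 /(eq _ h2) h6]]]]]; do ! split => //.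
move=> [[h1 [h2 h3]] [[h4 [h5 h6]] h7]]; do ! split => //; exact/eq.
Qed.

(** [tau E + M] is increasing in [tau], so its positivity at both ends suffices. *)
Lemma admissible_between Ra Ra0 M E tau : admissible Ra M E -> admissible Ra0 M E ->
  Rmin Ra0 Ra <= tau <= Rmax Ra0 Ra -> admissible tau M E.
Proof.
move=> [h1 [h2 h3]] [h4 [_ h6]]; rewrite /Rmin /Rmax /admissible.
by case: Rle_dec => ? [? ?]; do ! split; nra.
Qed.

Lemma J_closed_form sigma t0 Ra Ra0 M E t : admissible Ra M E -> admissible Ra0 M E ->
  J sigma t0 Ra Ra0 M E t = sqrt 2 * (t - t0) - sigma * (prim Ra M E - prim Ra0 M E).
Proof.
move=> a a0; rewrite /J; congr (_ - _ * _); apply: is_RInt_unique.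
apply: (is_RInt_derive (V:=R_CompleteNormedModule) (fun x => prim x M E)) => x
  /(admissible_between _ _ _ _ _ a a0).
  exact: is_derive_prim.
move=> [x0 [E0 m0]]; apply: (ex_derive_continuous (V:=R_NormedModule)).
auto_derive; do ! split => //; first lra.
by apply: Rdiv_lt_0_compat.
Qed.

Lemma locally_affine_gt0 a b x : 0 < a * x + b -> locally x (fun y => 0 < a * y + b).
Proof.
move=> h; have c : continuous (fun y => a * y + b) x.
  by apply: (ex_derive_continuous (V:=R_NormedModule)); auto_derive.
exact: (c _ (open_gt 0 _ h)).
Qed.

Lemma admissible_near_tau tau M E : admissible tau M E ->
  locally tau (fun x => admissible x M E).
Proof.
move=> [h1 [h2 h3]]; apply: filter_and; first exact: open_gt.
apply: filter_and; first by apply: filter_forall.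
have := locally_affine_gt0 E M tau; rewrite Rmult_comm => /(_ h3).
by apply: filter_imp => x; rewrite Rmult_comm.
Qed.

Lemma admissible_near_M tau M E : admissible tau M E ->
  locally M (fun x => admissible tau x E).
Proof.
move=> [h1 [h2 h3]]; apply: filter_and; first by apply: filter_forall.
apply: filter_and; first by apply: filter_forall.
have := locally_affine_gt0 1 (tau * E) M; rewrite Rmult_1_l Rplus_comm => /(_ h3).
by apply: filter_imp => x; rewrite Rmult_1_l Rplus_comm.
Qed.

Lemma admissible_near_E tau M E : admissible tau M E ->
  locally E (fun x => admissible tau M x).
Proof.
move=> [h1 [h2 h3]]; apply: filter_and; first by apply: filter_forall.
apply: filter_and; first exact: open_gt.
exact: locally_affine_gt0.
Qed.

(** Admissibility is an open condition, so the closed form holds near the point and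
    may be differentiated in place of [J]; likewise for the other three derivatives. *)
Lemma J_RaE sigma t0 Ra Ra0 M E t : admissible Ra M E -> admissible Ra0 M E ->
  J_Ra sigma t0 Ra Ra0 M E t = - (sigma * sqrt (Ra / (Ra * E + M))).
Proof.
move=> adm adm0; apply: is_derive_unique.
apply: (is_derive_ext_loc (fun x => sqrt 2 * (t - t0) - sigma * (prim x M E - prim Ra0 M E))).
  by apply: filter_imp (admissible_near_tau _ _ _ adm) => x h; rewrite J_closed_form.
have h := is_derive_prim _ _ _ adm; auto_derive.
  by exists (sqrt (Ra / (Ra * E + M))).
by rewrite (is_derive_unique _ _ _ h); ring.
Qed.

Lemma J_Ra0E sigma t0 Ra Ra0 M E t : admissible Ra M E -> admissible Ra0 M E ->
  J_Ra0 sigma t0 Ra Ra0 M E t = sigma * sqrt (Ra0 / (Ra0 * E + M)).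
Proof.
move=> adm adm0; apply: is_derive_unique.
apply: (is_derive_ext_loc (fun x => sqrt 2 * (t - t0) - sigma * (prim Ra M E - prim x M E))).
  by apply: filter_imp (admissible_near_tau _ _ _ adm0) => x h; rewrite J_closed_form.
have h := is_derive_prim _ _ _ adm0; auto_derive.
  by exists (sqrt (Ra0 / (Ra0 * E + M))).
by rewrite (is_derive_unique _ _ _ h); ring.
Qed.

Lemma J_ME sigma t0 Ra Ra0 M E t : admissible Ra M E -> admissible Ra0 M E ->
  J_M sigma t0 Ra Ra0 M E t = - (sigma * (prim_M Ra M E - prim_M Ra0 M E)).
Proof.
move=> adm adm0; apply: is_derive_unique.
apply: (is_derive_ext_loc (fun x => sqrt 2 * (t - t0) - sigma * (prim Ra x E - prim Ra0 x E))).
  apply: filter_imp (filter_and _ _ (admissible_near_M _ _ _ adm) (admissible_near_M _ _ _ adm0)).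
  by move=> x [h h']; rewrite J_closed_form.
have h := is_derive_prim_M _ _ _ adm; have h0 := is_derive_prim_M _ _ _ adm0; auto_derive.
  by do ! split => //; [exists (prim_M Ra M E) | exists (prim_M Ra0 M E)].
by rewrite (is_derive_unique _ _ _ h) (is_derive_unique _ _ _ h0); ring.
Qed.

Lemma J_EE sigma t0 Ra Ra0 M E t : admissible Ra M E -> admissible Ra0 M E ->
  J_E sigma t0 Ra Ra0 M E t = - (sigma * (prim_E Ra M E - prim_E Ra0 M E)).
Proof.
move=> adm adm0; apply: is_derive_unique.
apply: (is_derive_ext_loc (fun x => sqrt 2 * (t - t0) - sigma * (prim Ra M x - prim Ra0 M x))).
  apply: filter_imp (filter_and _ _ (admissible_near_E _ _ _ adm) (admissible_near_E _ _ _ adm0)).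
  by move=> x [h h']; rewrite J_closed_form.
have h := is_derive_prim_E _ _ _ adm; have h0 := is_derive_prim_E _ _ _ adm0; auto_derive.
  by do ! split => //; [exists (prim_E Ra M E) | exists (prim_E Ra0 M E)].
by rewrite (is_derive_unique _ _ _ h) (is_derive_unique _ _ _ h0); ring.
Qed.


Ltac smooth_term_tac :=
  repeat (first [ assumption
    | lazymatch goal with
      | |- smooth_term _ (fun x => @?a x + @?b x) => apply (term_plus _ a b)
      | |- smooth_term _ (fun x => @?a x - @?b x) => apply (term_minus _ a b)
      | |- smooth_term _ (fun x => @?a x * @?b x) => apply (term_mult _ a b)
      | |- smooth_term _ (fun x => @?a x / @?b x) => apply (term_div _ a b)
      | |- smooth_term _ (fun x => - @?a x) => apply (term_opp _ a)
      | |- smooth_term _ (fun x => / @?a x) => apply (term_inv _ a)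
      | |- smooth_term _ (fun x => sqrt (@?a x)) => apply (term_sqrt _ a)
      | |- smooth_term _ (fun x => ln (@?a x)) => apply (term_ln _ a)
      | |- smooth_term _ (fun x => (@?a x) ^ ?n) => apply (term_pow _ a n)
      | |- smooth_term _ (fun x => x ?i) => apply term_coord
      | |- smooth_term _ (fun x => ?c) => apply term_const
      end ]).

Lemma term_prim_M {I : Type} (x0 : I -> R) tau M E :
  smooth_term x0 tau -> smooth_term x0 M -> smooth_term x0 E ->
  admissible (tau x0) (M x0) (E x0) -> smooth_term x0 (fun x => prim_M (tau x) (M x) (E x)).
Proof.
move=> t1 t2 t3 adm; have [h1 [h2 [h3 [h4 [h5 [h6 h7]]]]]] := admissible_sqrt _ _ _ adm.
case: adm => a0 [E0 m0].
have e0 : 0 < E x0 * sqrt (E x0) by exact: Rmult_lt_0_compat.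
have q0 : 0 < 2 * sqrt (tau x0 * (tau x0 * E x0 + M x0)) * E x0.
  by apply: Rmult_lt_0_compat => //; lra.
by rewrite /prim_M; smooth_term_tac; lra.
Qed.

Lemma term_prim_E {I : Type} (x0 : I -> R) tau M E :
  smooth_term x0 tau -> smooth_term x0 M -> smooth_term x0 E ->
  admissible (tau x0) (M x0) (E x0) -> smooth_term x0 (fun x => prim_E (tau x) (M x) (E x)).
Proof.
move=> t1 t2 t3 adm; have [h1 [h2 [h3 [h4 [h5 [h6 h7]]]]]] := admissible_sqrt _ _ _ adm.
case: adm => a0 [E0 m0].
have e0 : 0 < E x0 * sqrt (E x0) by exact: Rmult_lt_0_compat.
have ee0 : 0 < E x0 * E x0 by exact: Rmult_lt_0_compat.
have eee0 := Rmult_lt_0_compat _ _ e0 e0.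
have q0 : 0 < 2 * sqrt (tau x0 * (tau x0 * E x0 + M x0)) * E x0.
  by apply: Rmult_lt_0_compat => //; lra.
by rewrite /prim_E; smooth_term_tac; lra.
Qed.

Lemma term_sqrt_ratio {I : Type} (x0 : I -> R) tau M E :
  smooth_term x0 tau -> smooth_term x0 M -> smooth_term x0 E ->
  admissible (tau x0) (M x0) (E x0) ->
  smooth_term x0 (fun x => sqrt (tau x / (tau x * E x + M x))).
Proof.
move=> t1 t2 t3 [a0 [E0 m0]]; smooth_term_tac; last lra.
exact: Rdiv_lt_0_compat.
Qed.

Lemma J_Ra_neq0 sigma t0 Ra Ra0 M E t : (sigma = 1 \/ sigma = -1) ->
  admissible Ra M E -> admissible Ra0 M E -> - J_Ra sigma t0 Ra Ra0 M E t <> 0.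
Proof.
move=> s1 adm adm0; rewrite J_RaE //.
have := sqrt_lt_R0 (Ra / (Ra * E + M)); case: adm => a0 [E0 m0].
by move=> /(_ (Rdiv_lt_0_compat _ _ a0 m0)); case: s1 => ->; lra.
Qed.

(** [den2] up to the nonzero factor [- sigma / (- J_Ra)]; it is free of [sigma], so
    that membership in T for one sign gives [den2 <> 0] for either sign. *)
Definition den2_numerator (dE dRa0 Ra Ra0 M E : R) : R :=
  dE * Ra * (prim_M Ra M E - prim_M Ra0 M E)
  - dE * (prim_E Ra M E - prim_E Ra0 M E) + dRa0 * sqrt (Ra0 / (Ra0 * E + M)).

Lemma den2E sigma t0 dE dRa0 Ra Ra0 M E t : (sigma = 1 \/ sigma = -1) ->
  admissible Ra M E -> admissible Ra0 M E ->
  den2 sigma t0 dE dRa0 Ra Ra0 M E t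
  = - (sigma * den2_numerator dE dRa0 Ra Ra0 M E) / - J_Ra sigma t0 Ra Ra0 M E t.
Proof.
move=> s1 adm adm0; have := J_Ra_neq0 sigma t0 Ra Ra0 M E t s1 adm adm0.
rewrite /den2 /F /G /den2_numerator J_ME // J_EE // J_Ra0E //.
by move=> n0; field; lra.
Qed.

Lemma in_T_regular t0 dE dRa0 Ra Ra0 M E t : in_T t0 dE dRa0 Ra Ra0 M E t ->
  region Ra Ra0 M E t /\ den2_numerator dE dRa0 Ra Ra0 M E <> 0.
Proof.
move=> inT.
have [s' [inO npi]] : exists s', in_O s' t0 Ra Ra0 M E t /\
    ~ in_piM s' t0 dE dRa0 Ra Ra0 M E t.
  by case: inT => -[? ?]; [exists 1 | exists (-1)].
have reg := proj1 inO; split=> //.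
have [adm [adm0 _]] := proj1 (region_admissible _ _ _ _ _) reg.
move=> n0; apply: npi; split=> //.
rewrite J_ME // J_EE // J_Ra0E //; apply: Rminus_diag_uniq.
by rewrite -[RHS](Rmult_0_r (- s')) -n0 /den2_numerator; ring.
Qed.

Lemma den2_neq0 sigma t0 dE dRa0 Ra Ra0 M E t : (sigma = 1 \/ sigma = -1) ->
  in_T t0 dE dRa0 Ra Ra0 M E t -> den2 sigma t0 dE dRa0 Ra Ra0 M E t <> 0.
Proof.
move=> s1 /in_T_regular [/region_admissible [adm [adm0 _]] n0].
rewrite den2E //; apply: Rmult_integral_contrapositive_currified.
  by apply: Ropp_neq_0_compat; apply: Rmult_integral_contrapositive_currified => //; lra.
by apply: Rinv_neq_0_compat; apply: J_Ra_neq0.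
Qed.

Lemma W_sqr sigma Ra M E : (sigma = 1 \/ sigma = -1) -> 0 < E + M / Ra ->
  W sigma Ra M E * W sigma Ra M E = 2 * E + 2 * M / Ra /\ W sigma Ra M E <> 0.
Proof.
move=> s1 h.
have h2 : 0 < 2 * E + 2 * M / Ra by rewrite /Rdiv Rmult_assoc -/(Rdiv _ _); lra.
have s0 := sqrt_lt_R0 _ h2; have ss := sqrt_sqrt _ (Rlt_le _ _ h2).
by rewrite /W; case: s1 => ->; split; nra.
Qed.

(** [W^2 = 2E + 2M/R], so if [den1] vanished, squaring [delta W = sqrt (1 + 2E)]
    would give [2M/R = 1]. *)
Lemma den1_neq0 sigma delta Ra M E : (sigma = 1 \/ sigma = -1) -> (delta = 1 \/ delta = -1) ->
  0 < Ra -> 0 < E -> 0 < E + M / Ra -> Ra <> 2 * M -> den1 sigma delta Ra M E <> 0.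
Proof.
move=> s1 d1 R0 E0 h ne z; apply: ne.
have [WW _] := W_sqr _ _ _ _ s1 h.
have h1 : 0 <= 1 + 2 * E by lra.
have ss := sqrt_sqrt _ h1; move: z; rewrite /den1.
set w := W _ _ _ _ in WW *; set q := sqrt _ in ss * => z.
have : w * w = q * q.
  have -> : q = delta * w by lra.
  by case: d1 => ->; ring.
rewrite WW ss => e.
have : 2 * M / Ra = 1 by lra.
by move=> /(f_equal (fun y => y * Ra)); rewrite /Rdiv Rmult_assoc Rinv_l; lra.
Qed.

Lemma locally_admissible {I : Type} (x0 : I -> R) tau M E :
  smooth_term x0 tau -> smooth_term x0 M -> smooth_term x0 E ->
  admissible (tau x0) (M x0) (E x0) ->
  locally (x0 : fct_UniformSpace I R_UniformSpace)
    (fun x => admissible (tau x) (M x) (E x)).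
Proof.
move=> t1 t2 t3 [h1 [h2 h3]].
do ! apply: filter_and; apply: smooth_term_gt0 => //; smooth_term_tac.
Qed.

(** Each partial derivative of [J] equals its closed form near the base point. *)
Lemma term_FG {I : Type} sigma t0 (x0 : I -> R) dE dRa0 Ra Ra0 M E t :
  (sigma = 1 \/ sigma = -1) ->
  smooth_term x0 dE -> smooth_term x0 dRa0 -> smooth_term x0 Ra -> smooth_term x0 Ra0 ->
  smooth_term x0 M -> smooth_term x0 E ->
  admissible (Ra x0) (M x0) (E x0) -> admissible (Ra0 x0) (M x0) (E x0) ->
  smooth_term x0 (fun x => F sigma t0 (dE x) (dRa0 x) (Ra x) (Ra0 x) (M x) (E x) (t x)) /\
  smooth_term x0 (fun x => G sigma t0 (Ra x) (Ra0 x) (M x) (E x) (t x)).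
Proof.
move=> s1 t1 t2 t3 t4 t5 t6 adm adm0.
have near : locally (x0 : fct_UniformSpace I R_UniformSpace)
    (fun x => admissible (Ra x) (M x) (E x) /\ admissible (Ra0 x) (M x) (E x)).
  by apply: filter_and; apply: locally_admissible.
have d0 := J_Ra_neq0 sigma t0 _ _ _ _ (t x0) s1 adm adm0.
have tR := term_sqrt_ratio _ _ _ _ t3 t5 t6 adm.
have tR0 := term_sqrt_ratio _ _ _ _ t4 t5 t6 adm0.
have tM := term_prim_M _ _ _ _ t3 t5 t6 adm; have tM0 := term_prim_M _ _ _ _ t4 t5 t6 adm0.
have tE := term_prim_E _ _ _ _ t3 t5 t6 adm; have tE0 := term_prim_E _ _ _ _ t4 t5 t6 adm0.
have ext f g : (forall x, admissible (Ra x) (M x) (E x) -> admissible (Ra0 x) (M x) (E x) ->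
    f x = g x) -> smooth_term x0 f -> smooth_term x0 g.
  move=> fg tf; apply: (term_ext x0 f g _ tf).
  by apply: filter_imp near => x [a b]; apply: fg.
have tJ : smooth_term x0 (fun x => - J_Ra sigma t0 (Ra x) (Ra0 x) (M x) (E x) (t x)).
  apply: (ext (fun x => - - (sigma * sqrt (Ra x / (Ra x * E x + M x))))).
    by move=> x a b; rewrite J_RaE.
  by smooth_term_tac.
have tJM : smooth_term x0 (fun x => J_M sigma t0 (Ra x) (Ra0 x) (M x) (E x) (t x)).
  apply: (ext (fun x => - (sigma * (prim_M (Ra x) (M x) (E x) - prim_M (Ra0 x) (M x) (E x))))).
    by move=> x a b; rewrite J_ME.
  by smooth_term_tac.
have tJE : smooth_term x0 (fun x => J_E sigma t0 (Ra x) (Ra0 x) (M x) (E x) (t x)).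
  apply: (ext (fun x => - (sigma * (prim_E (Ra x) (M x) (E x) - prim_E (Ra0 x) (M x) (E x))))).
    by move=> x a b; rewrite J_EE.
  by smooth_term_tac.
have tJ0 : smooth_term x0 (fun x => J_Ra0 sigma t0 (Ra x) (Ra0 x) (M x) (E x) (t x)).
  apply: (ext (fun x => sigma * sqrt (Ra0 x / (Ra0 x * E x + M x)))).
    by move=> x a b; rewrite J_Ra0E.
  by smooth_term_tac.
by split; rewrite /F /G; smooth_term_tac.
Qed.

(** * The matrix and the system *)

Lemma det_mx3 (a11 a12 a13 a21 a22 a23 a31 a32 a33 : R) :
  determinant (mx3 a11 a12 a13 a21 a22 a23 a31 a32 a33) =
  a11 * (a22 * a33 - a23 * a32) - a12 * (a21 * a33 - a23 * a31)
  + a13 * (a21 * a32 - a22 * a31).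
Proof.
rewrite (expand_det_row _ ord0) !big_ord_recl big_ord0 /cofactor.
rewrite !(expand_det_row _ ord0) !big_ord_recl !big_ord0 /cofactor !det_mx11 !mxE /=.
rewrite !GRing.exprS !GRing.expr0 -!(RplusE, RmultE, RoppE, R1E, R0E).
ring.
Qed.

(** Subtracting [delta B] times the third row from the second leaves
    [(0, A - delta B W, 0)] there, and [A - delta B W = - B den1]; the complementary
    minor is [den2 / Ra]. *)
Lemma U_unitmx sigma delta t0 z dE dRa0 Ra Ra0 M E t :
  1 + z <> 0 -> Ra <> 0 -> W sigma Ra M E <> 0 ->
  den1 sigma delta Ra M E <> 0 -> den2 sigma t0 dE dRa0 Ra Ra0 M E t <> 0 ->
  U sigma delta t0 z dE dRa0 Ra Ra0 M E t \in unitmx.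
Proof.
move=> z1 R0 W0 n1 n2; rewrite unitmxE GRing.unitfE; apply/eqP.
have -> : determinant (U sigma delta t0 z dE dRa0 Ra Ra0 M E t) =
  - (W sigma Ra M E / (1 + z) * den1 sigma delta Ra M E
     * (den2 sigma t0 dE dRa0 Ra Ra0 M E t / Ra)) :> R.
  rewrite /U det_mx3 /den1 /den2 /A /B; set w := W _ _ _ _.
  by field.
by apply: Ropp_neq_0_compat; do ! apply: Rmult_integral_contrapositive_currified => //;
  apply: Rinv_neq_0_compat.
Qed.

(** The independent variable is a coordinate of the autonomous system. *)
Inductive coord := cz | cr | ct | cM.

Lemma coord_finite : finite_index coord.
Proof. by exists [:: cz; cr; ct; cM] => -[]; rewrite /=; tauto. Qed.

Definition coords (z r t M : R) (i : coord) : R :=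
  match i with cz => z | cr => r | ct => t | cM => M end.

Section LTB.

Context (sigma delta t0 : R) (Dr Dz : R -> Prop) (Efun Ra0fun Rafun : R -> R).

Definition ltb_field (x : coord -> R) (i : coord) : R :=
  match i with
  | cz => 1
  | cr => rhs_r sigma delta t0 (x cz) (Derive Rafun (x cz)) (Derive Efun (x cr))
            (Derive Ra0fun (x cr)) (Rafun (x cz)) (Ra0fun (x cr)) (x cM) (Efun (x cr)) (x ct)
  | ct => rhs_t sigma delta (Derive Rafun (x cz)) (Rafun (x cz)) (x cM) (Efun (x cr))
  | cM => rhs_M sigma delta t0 (x cz) (Derive Rafun (x cz)) (Derive Efun (x cr))
            (Derive Ra0fun (x cr)) (Rafun (x cz)) (Ra0fun (x cr)) (x cM) (Efun (x cr)) (x ct)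
  end.

Definition ltb_domain (x : coord -> R) : Prop :=
  ode_domain sigma delta t0 Dr Dz Efun Ra0fun Rafun (x cz) (x cr) (x ct) (x cM).

Lemma smooth_on_term (P : R -> Prop) h x (i : coord) : open P -> smooth_on P h -> P (x i) ->
  smooth_term x (fun y => h (y i)) /\ smooth_term x (fun y => Derive h (y i)).
Proof.
move=> oP hP Px; split; apply: (term_comp _ _ (fun y : coord -> R => y i)) (term_coord _ _);
  apply: (smooth_on_smooth_at P) => //.
exact: smooth_on_Derive.
Qed.

Lemma ltb_terms x : (sigma = 1 \/ sigma = -1) -> open Dr -> open Dz ->
  smooth_on Dr Efun -> smooth_on Dr Ra0fun -> smooth_on Dz Rafun -> ltb_domain x ->
  (forall i, smooth_term x (fun y => ltb_field y i)) /\
  locally (x : fct_UniformSpace coord R_UniformSpace) ltb_domain.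
Proof.
move=> s1 oDr oDz sE sRa0 sRa [Dzx [Drx [z1 [reg [n1 n2]]]]].
have [tE tdE] := smooth_on_term Dr Efun x cr oDr sE Drx.
have [tRa0 tdRa0] := smooth_on_term Dr Ra0fun x cr oDr sRa0 Drx.
have [tRa tdRa] := smooth_on_term Dz Rafun x cz oDz sRa Dzx.
have tM := term_coord x cM; have tz := term_coord x cz; have tr := term_coord x cr.
have tct := term_coord x ct.
have [adm [adm0 tpos]] := proj1 (region_admissible _ _ _ _ _) reg.
have [tF tG] := term_FG sigma t0 x _ _ _ _ _ _ (fun y => y ct) s1 tdE tdRa0 tRa tRa0 tM tE adm adm0.
move: (reg) => [Ra_pos [_ [_ [E_pos [EM _]]]]].
have sqW : 0 < 2 * Efun (x cr) + 2 * x cM / Rafun (x cz).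
  by rewrite /Rdiv Rmult_assoc -/(Rdiv _ _); lra.
have tW : smooth_term x (fun y => W sigma (Rafun (y cz)) (y cM) (Efun (y cr))).
  by rewrite /W; smooth_term_tac; lra.
have tA : smooth_term x (fun y => A sigma (y cz) (Rafun (y cz)) (y cM) (Efun (y cr))).
  by rewrite /A /B; smooth_term_tac; lra.
have t1 : smooth_term x (fun y => den1 sigma delta (Rafun (y cz)) (y cM) (Efun (y cr))).
  by rewrite /den1; smooth_term_tac; lra.
have t2 : smooth_term x (fun y => den2 sigma t0 (Derive Efun (y cr)) (Derive Ra0fun (y cr))
    (Rafun (y cz)) (Ra0fun (y cr)) (y cM) (Efun (y cr)) (y ct)).
  by rewrite /den2; smooth_term_tac.
split.
  have n12 := Rmult_integral_contrapositive_currified _ _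
    (Rmult_integral_contrapositive_currified _ _ (Rgt_not_eq _ _ Ra_pos) n1) n2.
  case; rewrite /ltb_field /rhs_r /rhs_t /rhs_M /=; smooth_term_tac => //; lra.
have cont i (P : R -> Prop) : open P -> P (x i) ->
    locally (x : fct_UniformSpace coord R_UniformSpace) (fun y => P (y i)).
  by move=> oP Pi; apply: (smooth_term_continuous _ _ (term_coord x i) P (oP _ Pi)).
apply: filter_and; first exact: cont.
apply: filter_and; first exact: cont.
apply: filter_and.
  by apply: (smooth_term_neq0 x (fun y => 1 + y cz)) => //; smooth_term_tac.
apply: filter_and; last first.
  by apply: filter_and; [apply: (smooth_term_neq0 _ _ t1) | apply: (smooth_term_neq0 _ _ t2)].
have near : locally (x : fct_UniformSpace coord R_UniformSpace) (fun y =>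
    admissible (Rafun (y cz)) (y cM) (Efun (y cr)) /\
    admissible (Ra0fun (y cr)) (y cM) (Efun (y cr)) /\ 0 < y ct).
  apply: filter_and; first exact: (locally_admissible _ _ _ _ tRa tM tE adm).
  apply: filter_and; first exact: (locally_admissible _ _ _ _ tRa0 tM tE adm0).
  exact: (smooth_term_gt0 _ _ tct tpos).
by apply: filter_imp near => y /region_admissible.
Qed.

End LTB.

(** An integral curve of the autonomous field is thereby a solution of the original,
    time-dependent system. *)
Lemma clock_coordinate sigma delta t0 Efun Ra0fun Rafun (X : R -> coord -> R) a b z0 :
  a < z0 < b -> X z0 cz = z0 ->
  (forall z, a < z < b -> integral_curve (ltb_field sigma delta t0 Efun Ra0fun Rafun) X z) ->
  forall z, a < z < b -> X z cz = z.
Proof.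
move=> z0ab X0 dX z zab.
have inab y : Rmin z0 z <= y <= Rmax z0 z -> a < y < b.
  by rewrite /Rmin /Rmax; case: Rle_dec => ? ?; lra.
have [|y yh|y [_]] := MVT_gen (fun s => X s cz) z0 z (fun _ => 1).
- by move=> y yh; apply: (dX y _ cz); apply: inab; lra.
- apply/continuity_pt_filterlim; apply: (ex_derive_continuous (V:=R_NormedModule)).
  by exists 1; apply: (dX y _ cz); apply: inab.
- by rewrite /= X0; lra.
Qed.

Theorem proposition1p14 (sigma delta t0 : R) (Dr Dz : R -> Prop)
    (Efun Ra0fun Rafun : R -> R)
    (hsigma : sigma = 1 \/ sigma = -1) (hdelta : delta = 1 \/ delta = -1) (ht0 : 0 < t0)
    (hDr : open Dr) (hDz : open Dz)
    (hE : smooth_on Dr Efun) (hRa0 : smooth_on Dr Ra0fun)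
    (hRafun : smooth_on Dz Rafun) (hRapos : forall z : R, Dz z -> 0 < Rafun z) :
  (forall z r t M : R, Dz z -> Dr r -> 1 + z <> 0 ->
     Rafun z <> 2 * M ->
     in_T t0 (Derive Efun r) (Derive Ra0fun r)
          (Rafun z) (Ra0fun r) M (Efun r) t ->
     U sigma delta t0 z (Derive Efun r) (Derive Ra0fun r)
       (Rafun z) (Ra0fun r) M (Efun r) t \in unitmx)
  /\
  (forall z0 r0 t1 M0 : R, 0 < z0 -> Dz z0 -> Dr r0 ->
     Rafun z0 <> 2 * M0 ->
     in_T t0 (Derive Efun r0) (Derive Ra0fun r0)
          (Rafun z0) (Ra0fun r0) M0 (Efun r0) t1 ->
     exists a b : R, a < z0 < b /\
       (exists r t M : R -> R,
          smooth_solution_through sigma delta t0 Dr Dz Efun Ra0fun Rafun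
            a b z0 r0 t1 M0 r t M /\
          (forall r' t' M' : R -> R,
             smooth_solution_through sigma delta t0 Dr Dz Efun Ra0fun Rafun
               a b z0 r0 t1 M0 r' t' M' ->
             forall z : R, a < z < b ->
               r' z = r z /\ t' z = t z /\ M' z = M z))).
Proof.
split=> [z r t M Dzz Drr z1 ne inT|z0 r0 t1 M0 z0pos Dz0 Dr0 ne inT].
  have [reg _] := in_T_regular _ _ _ _ _ _ _ _ inT.
  have [Ra_pos [_ [_ [E_pos [EM _]]]]] := reg.
  have [_ W0] := W_sqr _ _ _ _ hsigma EM.
  apply: U_unitmx => //; first lra.
    exact: den1_neq0.
  exact: den2_neq0.
have [reg _] := in_T_regular _ _ _ _ _ _ _ _ inT.
have [Ra_pos [_ [_ [E_pos [EM _]]]]] := reg.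
have D0 : ltb_domain sigma delta t0 Dr Dz Efun Ra0fun Rafun (coords z0 r0 t1 M0).
  do ! split => //=; try by case: reg => [? [? [? [? [? ?]]]]].
  - lra.
  - exact: den1_neq0.
  - exact: den2_neq0.
have terms x := ltb_terms sigma delta t0 Dr Dz Efun Ra0fun Rafun x hsigma hDr hDz hE hRa0 hRafun.
have [a [b [z0ab [X [X0 [dX uX]]]]]] := local_flow _ _ _ z0 coord_finite
  (fun x Dx => proj2 (terms x Dx)) (fun x Dx => proj1 (terms x Dx)) D0.
have Xz := clock_coordinate _ _ _ _ _ _ X a b z0 z0ab (X0 cz)
  (fun z zab => proj1 (proj2 (dX z zab))).
exists a, b; split=> //.
exists (fun z => X z cr), (fun z => X z ct), (fun z => X z cM); split.
  have sX i : smooth_on (fun z => a < z < b) (fun z => X z i).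
    by move=> n z zab; apply: ndiff_ex_derive_n; apply: (proj2 (proj2 (dX z zab)) i n).
  split; first exact: sX.
  split; first exact: sX.
  split; first exact: sX.
  split; last by rewrite !X0.
  move=> z zab; have [Dx [cX _]] := dX z zab.
  have := Xz z zab; move: Dx (cX cr) (cX ct) (cX cM).
  by rewrite /ltb_domain /= => Dx c1 c2 c3 e; rewrite e in Dx c1 c2 c3.
move=> r t M [_ [_ [_ [sol [er [et eM]]]]]] z zab.
(* With [z] adjoined, any other solution is an integral curve of the same field. *)
pose Y z := coords z (r z) (t z) (M z).
have Yu : forall z, a < z < b -> forall i, Y z i = X z i.
  apply: uX => [s /sol [Ds [d1 [d2 d3]]]|]; last by case; rewrite /Y /= ?er ?et ?eM.
  split=> // -[] //=; exact: is_derive_id.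
by split; [|split]; [apply: (Yu z zab cr) | apply: (Yu z zab ct) | apply: (Yu z zab cM)].
Qed.
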